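(* For any ring $R$ with unit, the category $\mathbf{RMod}_{pure}$ of left $R$-modules with pure monomorphisms as morphisms has a stable independence notion.
   Context: An independence notion on a category $\mathcal{K}$ is a class of commutative squares $A\to B\to D$, $A\to C\to D$ (called independent) such that for any such square together with a morphism $D\to E$, the square on $A,B,C,D$ is independent iff the square on $A,B,C,E$ is. It is weakly stable if it satisfies Symmetry (closed under swapping the roles of $B$ and $C$), Transitivity (closed under horizontal and vertical composition of squares), Existence (every span $B\leftarrow A\to C$ completes to an independent square), and Uniqueness (any two independent completions $B\to D_1\leftarrow C$, $B\to D_2\leftarrow C$ of a span admit $E$ and maps $D_1\to E$, $D_2\to E$ making the composites from $B$ agree and the composites from $C$ agree). $\mathcal{K}_\downarrow$ denotes the subcategory of the arrow category $\mathcal{K}^2$ with all morphisms of $\mathcal{K}$ as objects and independent squares as morphisms. A stable independence notion is a weakly stable one for which $\mathcal{K}_\downarrow$ is an accessible category. *)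

(* Defs.v *)
From HB Require Import structures.
From mathcomp Require Import all_boot all_order all_algebra.
From mathcomp Require Import boolp classical_sets functions cardinality.

Set Implicit Arguments.
Unset Strict Implicit.
Unset Printing Implicit Defensive.

Import GRing.Theory.
Local Open Scope classical_set_scope.
Local Open Scope card_scope.
Local Open Scope ring_scope.

(* "Set", as opposed to "class": the universe in which the carriers of modules
   live.  Naming it explicitly makes the sets of morphisms, the index posets,
   the cardinals and the sets of presentable generators below range over
   exactly the same universe as the carriers of modules; classes, such as the
   collection of all modules, live in strictly larger universes. *)
Notation small := Type@{GRing.Lmodule.axioms_.u0} (only parsing).

(** * Categories *)

Record category := Category {
  Ob :> Type;
  mor : Ob -> Ob -> small;
  idm : forall A, mor A A;
  compm : forall A B C, mor B C -> mor A B -> mor A C;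
  comp1m : forall A B (f : mor A B), compm (idm B) f = f;
  compm1 : forall A B (f : mor A B), compm f (idm A) = f;
  compmA : forall A B C D (h : mor C D) (g : mor B C) (f : mor A B),
    compm h (compm g f) = compm (compm h g) f
}.

Arguments mor {_} _ _.
Arguments idm {_} _.
Arguments compm {_ _ _ _} _ _.

Declare Scope cat_scope.
Delimit Scope cat_scope with cat.
Notation "g ∘ f" := (compm g f) (at level 40, left associativity) : cat_scope.
Local Open Scope cat_scope.

Definition sets : category :=
  @Category small (fun A B => A -> B) (fun A x => x) (fun A B C g f x => g (f x))
    (fun _ _ _ => erefl) (fun _ _ _ => erefl) (fun _ _ _ _ _ _ _ => erefl).

(** * Regular cardinals and directed posets *)

(* Cardinals are represented by small types. *)

Definition regular_cardinal (L : small) : Prop :=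
  [set: nat] #<= [set: L] /\
  forall (I : small) (X : I -> small),
    ~ ([set: L] #<= [set: I]) ->
    (forall i, ~ ([set: L] #<= [set: X i])) ->
    ~ ([set: L] #<= [set: {i : I & X i}]).

Record poset := Poset {
  pcar :> small;
  ple : pcar -> pcar -> Prop;
  ple_refl : forall i, ple i i;
  ple_trans : forall i j k, ple i j -> ple j k -> ple i k;
  ple_anti : forall i j, ple i j -> ple j i -> i = j
}.

Definition directed (L : small) (P : poset) : Prop :=
  forall S : set P, ~ ([set: L] #<= S) -> exists u : P, forall i, S i -> ple i u.

(** * Directed colimits *)

Record diagram (K : category) (P : poset) := Diagram {
  dob :> P -> K;
  dmap : forall i j, ple i j -> mor (dob i) (dob j);
  dmap_id : forall i (p : ple i i), dmap p = idm (dob i);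
  dmap_comp : forall i j k (p : ple i j) (q : ple j k) (r : ple i k),
    dmap r = dmap q ∘ dmap p
}.

Record cocone (K : category) (P : poset) (D : diagram K P) := Cocone {
  apex : K;
  leg : forall i, mor (D i) apex;
  legP : forall i j (p : ple i j), leg j ∘ dmap D p = leg i
}.

Definition is_colimit (K : category) (P : poset) (D : diagram K P)
    (c : cocone D) : Prop :=
  forall d : cocone D,
    exists! u : mor (apex c) (apex d), forall i, u ∘ leg c i = leg d i.

Section HomFunctor.
Variables (K : category) (A : K) (P : poset) (D : diagram K P).

Lemma hom_diagram_id i (p : ple i i) :
  (fun f : mor A (D i) => dmap D p ∘ f) = (fun f => f).
Proof. by apply/funext => f; rewrite dmap_id comp1m. Qed.

Lemma hom_diagram_comp i j k (p : ple i j) (q : ple j k) (r : ple i k) :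
  (fun f : mor A (D i) => dmap D r ∘ f) =
  (fun f => dmap D q ∘ (dmap D p ∘ f)).
Proof. by apply/funext => f; rewrite (dmap_comp D p q r) compmA. Qed.

Definition hom_diagram : diagram sets P :=
  @Diagram sets P (fun i => mor A (D i)) (fun i j p f => dmap D p ∘ f)
    hom_diagram_id hom_diagram_comp.

Variable c : cocone D.

Lemma hom_coconeP i j (p : ple i j) :
  (fun f : mor A (D i) => leg c j ∘ (dmap D p ∘ f)) = (fun f => leg c i ∘ f).
Proof. by apply/funext => f; rewrite compmA legP. Qed.

Definition hom_cocone : cocone hom_diagram :=
  @Cocone sets P hom_diagram (mor A (apex c)) (fun i f => leg c i ∘ f)
    hom_coconeP.

End HomFunctor.

(** * Accessible categories *)

Definition presentable (K : category) (L : small) (A : K) : Prop :=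
  forall (P : poset) (D : diagram K P) (c : cocone D),
    directed L P -> is_colimit c -> is_colimit (hom_cocone A c).

Record accessible_at (K : category) (L : small) : Prop := AccessibleAt {
  has_directed_colimits :
    forall (P : poset) (D : diagram K P),
      directed L P -> exists c : cocone D, is_colimit c;
  has_presentable_generators :
    exists (S : small) (G : S -> K),
      (forall s, presentable L (G s)) /\
      (forall X : K, exists (P : poset) (D : diagram K P) (c : cocone D),
         [/\ directed L P, is_colimit c, apex c = X &
             forall i, exists s, D i = G s])
}.

Definition accessible (K : category) : Prop :=
  exists L : small, regular_cardinal L /\ accessible_at K L.

(** * Independence notions *)

(* [indep f g h k] is about the square with sides
   f : A -> B, g : A -> C, h : B -> D, k : C -> D. *)
Record independence (K : category) := Independence {
  indep : forall A B C D : K,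
    mor A B -> mor A C -> mor B D -> mor C D -> Prop;
  indep_commutes : forall (A B C D : K)
    (f : mor A B) (g : mor A C) (h : mor B D) (k : mor C D),
    indep f g h k -> h ∘ f = k ∘ g;
  indep_extend : forall (A B C D E : K)
    (f : mor A B) (g : mor A C) (h : mor B D) (k : mor C D) (t : mor D E),
    h ∘ f = k ∘ g -> (indep f g h k <-> indep f g (t ∘ h) (t ∘ k))
}.

Arguments indep {K} _ {A B C D} _ _ _ _.

Record weakly_stable (K : category) (I : independence K) : Prop :=
  WeaklyStable {
  indep_sym : forall (A B C D : K)
    (f : mor A B) (g : mor A C) (h : mor B D) (k : mor C D),
    indep I f g h k -> indep I g f k h;
  indep_htrans : forall (A B C D B' D' : K)
    (f : mor A B) (g : mor A C) (h : mor B D) (k : mor C D)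
    (f' : mor B B') (h' : mor B' D') (k' : mor D D'),
    indep I f g h k -> indep I f' h h' k' ->
    indep I (f' ∘ f) g h' (k' ∘ k);
  indep_vtrans : forall (A B C D C' D' : K)
    (f : mor A B) (g : mor A C) (h : mor B D) (k : mor C D)
    (g' : mor C C') (h' : mor D D') (k' : mor C' D'),
    indep I f g h k -> indep I k g' h' k' ->
    indep I f (g' ∘ g) (h' ∘ h) k';
  indep_existence : forall (A B C : K) (f : mor A B) (g : mor A C),
    exists (D : K) (h : mor B D) (k : mor C D), indep I f g h k;
  indep_uniqueness : forall (A B C D1 D2 : K) (f : mor A B) (g : mor A C)
    (h1 : mor B D1) (k1 : mor C D1) (h2 : mor B D2) (k2 : mor C D2),
    indep I f g h1 k1 -> indep I f g h2 k2 ->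
    exists (E : K) (t1 : mor D1 E) (t2 : mor D2 E),
      t1 ∘ h1 = t2 ∘ h2 /\ t1 ∘ k1 = t2 ∘ k2
}.

(** * The category of morphisms and independent squares *)

Record arrow (K : category) := Arrow {
  src : K;
  tgt : K;
  arr :> mor src tgt
}.

Record indep_square (K : category) (I : independence K) (f f' : arrow K) :=
  IndepSquare {
  sq_src : mor (src f) (src f');
  sq_tgt : mor (tgt f) (tgt f');
  sq_indep : indep I f sq_src sq_tgt f'
}.

Lemma indep_square_eq (K : category) (I : independence K) (f f' : arrow K)
    (s t : indep_square I f f') :
  sq_src s = sq_src t -> sq_tgt s = sq_tgt t -> s = t.
Proof.
case: s t => [a b p] [a' b' p'] /= e1 e2; subst a' b'.
by congr IndepSquare; apply: Prop_irrelevance.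
Qed.

Section Down.
Variables (K : category) (I : independence K) (wsI : weakly_stable I).

Lemma indep_id (A B : K) (f : mor A B) : indep I f (idm A) (idm B) f.
Proof.
have [D [h [k ind]]] := indep_existence wsI f (idm A).
have e := indep_commutes ind; rewrite compm1 in e.
apply/(indep_extend I h); first by rewrite comp1m compm1.
by rewrite compm1 e.
Qed.

Definition down_id (f : arrow K) : indep_square I f f :=
  IndepSquare (indep_id f).

Definition down_comp (f1 f2 f3 : arrow K) (t : indep_square I f2 f3)
    (s : indep_square I f1 f2) : indep_square I f1 f3 :=
  IndepSquare (indep_vtrans wsI (sq_indep s) (sq_indep t)).

Lemma down_idl f f' (s : indep_square I f f') :
  down_comp (down_id f') s = s.
Proof. by apply: indep_square_eq; apply: comp1m. Qed.

Lemma down_idr f f' (s : indep_square I f f') :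
  down_comp s (down_id f) = s.
Proof. by apply: indep_square_eq; apply: compm1. Qed.

Lemma down_assoc f1 f2 f3 f4 (u : indep_square I f3 f4)
    (t : indep_square I f2 f3) (s : indep_square I f1 f2) :
  down_comp u (down_comp t s) = down_comp (down_comp u t) s.
Proof. by apply: indep_square_eq; apply: compmA. Qed.

Definition down : category :=
  @Category (arrow K) (indep_square I) down_id down_comp
    down_idl down_idr down_assoc.

End Down.

Definition stable (K : category) (I : independence K) : Prop :=
  exists wsI : weakly_stable I, accessible (down wsI).

(** * Modules and pure monomorphisms *)

Definition finitely_presented (R : pzRingType) (X : lmodType R) : Prop :=
  exists (m n : nat) (r : {linear 'rV[R]_m -> 'rV[R]_n})
         (p : {linear 'rV[R]_n -> X}),
    (forall x, exists y, p y = x) /\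
    (forall y, p y = 0 <-> exists z, r z = y).

(* Purity in the sense of locally finitely presentable categories: every
   commutative square u : X -> M, g : X -> Y, v : Y -> N with X and Y finitely
   presented has u factoring through g. *)
Definition pure (R : pzRingType) (M N : lmodType R) (f : {linear M -> N}) :
    Prop :=
  forall (X Y : lmodType R) (g : {linear X -> Y})
         (u : {linear X -> M}) (v : {linear Y -> N}),
    finitely_presented X -> finitely_presented Y ->
    (forall x, f (u x) = v (g x)) ->
    exists t : {linear Y -> M}, forall x, t (g x) = u x.

Record pure_mono (R : pzRingType) (M N : lmodType R) := PureMono {
  pm_fun :> {linear M -> N};
  pm_inj : injective pm_fun;
  pm_pure : pure pm_fun
}.

Section RModPure.
Variable R : pzRingType.
Implicit Types M N P : lmodType R.

Lemma linear_eq M N (f g : {linear M -> N}) : f =1 g -> f = g.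
Proof.
case: f g => [f [[[a0 aD]] [aZ]]] [g [[[b0 bD]] [bZ]]] /= fg.
have e : f = g by apply/funext.
subst g; congr GRing.Linear.Pack; congr GRing.Linear.Class.
  by congr Algebra.isNmodMorphism.Axioms_; apply: Prop_irrelevance.
by congr GRing.isScalable.Axioms_; apply: Prop_irrelevance.
Qed.

Lemma pure_mono_eq M N (f g : pure_mono M N) : f =1 g -> f = g.
Proof.
case: f g => [f fi fp] [g gi gp] /= fg.
have e : f = g by apply: linear_eq.
by subst g; congr PureMono; apply: Prop_irrelevance.
Qed.

Lemma pure_id M : pure (idfun : {linear M -> M}).
Proof. by move=> X Y g u v _ _ e; exists v => x; rewrite -e. Qed.

Lemma pure_comp M N P (f : {linear M -> N}) (g : {linear N -> P}) :
  pure f -> pure g -> pure (g \o f : {linear M -> P}).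
Proof.
move=> pf pg X Y h u v fX fY e.
have [w we] := pg X Y h (f \o u : {linear X -> N}) v fX fY e.
by have [t te] := pf X Y h u w fX fY (fun x => esym (we x)); exists t.
Qed.

Definition pm_id M : pure_mono M M :=
  @PureMono R M M (idfun : {linear M -> M}) (fun x y e => e) (@pure_id M).

Definition pm_comp M N P (g : pure_mono N P) (f : pure_mono M N) :
    pure_mono M P :=
  @PureMono R M P (g \o f : {linear M -> P})
    (inj_comp (@pm_inj _ _ _ g) (@pm_inj _ _ _ f))
    (pure_comp (@pm_pure _ _ _ f) (@pm_pure _ _ _ g)).

Definition RMod_pure : category.
Proof.
refine (@Category (lmodType R) (@pure_mono R) pm_id pm_comp _ _ _).
- by move=> M N f; apply: pure_mono_eq.
- by move=> M N f; apply: pure_mono_eq.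
- by move=> M N P Q h g f; apply: pure_mono_eq.
Defined.

End RModPure.

(* Main.v *)
(** Purity of a map can be tested by tensoring it with the groups R^n/r(R^m), for
    all finite matrices r.  Call a commutative square of pure monomorphisms
    independent when each of these tensor products turns it into a pullback;
    equivalently, when the map out of the pushout of the span is again a pure
    monomorphism.  Each axiom of weak stability then becomes a short diagram
    chase.

    For accessibility, all pure monomorphisms are injective and the tensor
    products commute with directed colimits, so that a cocone of arrows and
    independent squares is colimiting as soon as its legs jointly cover the
    target of the apex.  Let kappa be a cardinal bounding |R| and aleph_0 with
    kappa^aleph_0 = kappa.  A Loewenheim-Skolem argument, closing a subset of the
    target under solutions of linear systems, shows that every arrow is the
    kappa^+-directed union of its independent subarrows of size at most kappa,
    and these are kappa^+-presentable. *)
From HB Require Import structures.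
From mathcomp Require Import all_boot all_algebra.
From mathcomp Require Import boolp classical_sets functions cardinality wochoice.
Require Import Defs.
From mathcomp Require Import ssralg.

Set Implicit Arguments.
Unset Strict Implicit.
Unset Printing Implicit Defensive.

Import GRing.Theory.
Local Open Scope classical_set_scope.
Local Open Scope card_scope.
Local Open Scope ring_scope.

(** * Modules presented by a carrier and a congruence *)

(** Fixing the carrier [T] makes the structures on it a small type, so that they later yield a set
    of generators. Negatives come from scaling by [-1]. *)
Record premodule (R : pzRingType) (T : small) : small := Premodule {
  peq : T -> T -> Prop;
  pzero : T;
  padd : T -> T -> T;
  pscale : R -> T -> T;
  peq_refl : forall x, peq x x;
  peq_sym : forall x y, peq x y -> peq y x;
  peq_trans : forall y x z, peq x y -> peq y z -> peq x z;
  padd_peq : forall x x' y y',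
    peq x x' -> peq y y' -> peq (padd x y) (padd x' y');
  pscale_peq : forall a x x', peq x x' -> peq (pscale a x) (pscale a x');
  paddA : forall x y z, peq (padd x (padd y z)) (padd (padd x y) z);
  paddC : forall x y, peq (padd x y) (padd y x);
  padd0 : forall x, peq (padd pzero x) x;
  pscale0 : forall x, peq (pscale 0 x) pzero;
  pscaleA : forall a b x, peq (pscale a (pscale b x)) (pscale (a * b) x);
  pscale1 : forall x, peq (pscale 1 x) x;
  pscaleDr : forall a x y,
    peq (pscale a (padd x y)) (padd (pscale a x) (pscale a y));
  pscaleDl : forall x a b,
    peq (pscale (a + b) x) (padd (pscale a x) (pscale b x))
}.

Section Quotient.
Variables (R : pzRingType) (T : small) (M : premodule R T).

Definition quot : small := {S : set T | exists x, S = peq M x}.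

HB.instance Definition _ := gen_eqMixin quot.
HB.instance Definition _ := gen_choiceMixin quot.

Definition qpi (x : T) : quot := exist _ (peq M x) (ex_intro _ x erefl).

Lemma qpi_eq x y : qpi x = qpi y <-> peq M x y.
Proof.
split=> [[e]|e]; first by rewrite e; apply: peq_refl.
apply: eq_exist => /=; apply/funext => z; apply/propext; split.
  by apply: peq_trans; apply: peq_sym.
exact: peq_trans.
Qed.

Lemma qpi_surj q : exists x, qpi x = q.
Proof. by case: q => S [x Sx]; exists x; apply: eq_exist. Qed.

Definition qrepr q : T := sval (cid (qpi_surj q)).

Lemma qreprK q : qpi (qrepr q) = q.
Proof. exact: svalP (cid (qpi_surj q)). Qed.

Lemma qrepr_pi x : peq M (qrepr (qpi x)) x.
Proof. by apply/qpi_eq; rewrite qreprK. Qed.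

Definition qadd p q := qpi (padd M (qrepr p) (qrepr q)).
Definition qscale a p := qpi (pscale M a (qrepr p)).

Lemma qaddE x y : qadd (qpi x) (qpi y) = qpi (padd M x y).
Proof. by apply/qpi_eq; apply: padd_peq; apply: qrepr_pi. Qed.

Lemma qscaleE a x : qscale a (qpi x) = qpi (pscale M a x).
Proof. by apply/qpi_eq; apply: pscale_peq; apply: qrepr_pi. Qed.

Lemma qaddA : associative qadd.
Proof.
move=> p q r; rewrite -(qreprK p) -(qreprK q) -(qreprK r) !qaddE.
by apply/qpi_eq; apply: paddA.
Qed.

Lemma qaddC : commutative qadd.
Proof.
move=> p q; rewrite -(qreprK p) -(qreprK q) !qaddE.
by apply/qpi_eq; apply: paddC.
Qed.

Lemma qadd0 : left_id (qpi (pzero M)) qadd.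
Proof. by move=> p; rewrite -(qreprK p) qaddE; apply/qpi_eq; apply: padd0. Qed.

Lemma qaddN : left_inverse (qpi (pzero M)) (qscale (-1)) qadd.
Proof.
move=> p; rewrite -(qreprK p) qscaleE qaddE; apply/qpi_eq.
apply: (peq_trans (y := pscale M (-1 + 1) (qrepr p))).
  apply: peq_sym; apply: (peq_trans (pscaleDl _ _ _ _)).
  by apply: padd_peq; [apply: peq_refl | apply: pscale1].
by rewrite addNr; apply: pscale0.
Qed.

HB.instance Definition _ :=
  GRing.isZmodule.Build quot qaddA qaddC qadd0 qaddN.

Lemma qscaleA a b p : qscale a (qscale b p) = qscale (a * b) p.
Proof.
by rewrite -(qreprK p) !qscaleE; apply/qpi_eq; apply: pscaleA.
Qed.

Lemma qscale1 : left_id 1 qscale.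
Proof. by move=> p; rewrite -(qreprK p) qscaleE; apply/qpi_eq/pscale1. Qed.

Lemma qscaleDr : right_distributive qscale +%R.
Proof.
move=> a p q; rewrite -(qreprK p) -(qreprK q).
have E x y : qpi x + qpi y = qpi (padd M x y) := qaddE x y.
by rewrite E !qscaleE E; apply/qpi_eq/pscaleDr.
Qed.

Lemma qscaleDl p : {morph qscale^~ p : a b / a + b}.
Proof.
move=> a b; rewrite -(qreprK p).
have E x y : qpi x + qpi y = qpi (padd M x y) := qaddE x y.
by rewrite !qscaleE E; apply/qpi_eq/pscaleDl.
Qed.

HB.instance Definition _ :=
  GRing.Zmodule_isLmodule.Build R quot qscaleA qscale1 qscaleDr qscaleDl.

Lemma qpiD x y : qpi (padd M x y) = qpi x + qpi y.
Proof. by rewrite -qaddE. Qed.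

Lemma qpiZ a x : qpi (pscale M a x) = a *: qpi x.
Proof. by rewrite -qscaleE. Qed.

End Quotient.

Section LinearMaps.
Variable R : pzRingType.
Implicit Types M N P X : lmodType R.

Definition mklin M N (f : M -> N) (lf : linear f) : {linear M -> N} :=
  HB.pack f (GRing.isLinear.Build R M N *:%R f lf).

Lemma quot_lift (T : small) (Q : premodule R T) N (f : T -> N) :
  (forall x y, peq Q x y -> f x = f y) ->
  (forall x y, f (padd Q x y) = f x + f y) ->
  (forall a x, f (pscale Q a x) = a *: f x) ->
  exists g : {linear quot Q -> N}, forall x, g (qpi Q x) = f x.
Proof.
move=> fE fD fZ; pose g (q : quot Q) := f (qrepr q).
have gE x : g (qpi Q x) = f x by apply/fE/qrepr_pi.
have gl : linear g.
  move=> a p q; rewrite -(qreprK p) -(qreprK q).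
  by rewrite -qpiZ -qpiD !gE fD fZ.
by exists (mklin gl).
Qed.

Lemma lin_factor X M N (f : {linear X -> N}) (i : {linear M -> N}) :
  injective i -> (forall x, exists y, i y = f x) ->
  exists g : {linear X -> M}, forall x, i (g x) = f x.
Proof.
move=> iI /choice[g gE].
have gl : linear g by move=> a x y; apply: iI; rewrite linearP !gE linearP.
by exists (mklin gl).
Qed.

(* Submodules are given as ranges of families, so that a submodule which is the
   range of a family indexed by a fixed type yields a premodule on that type. *)
Lemma range_submodule (T : small) M (e : T -> M) (t0 : T) :
  e t0 = 0 -> (forall s t, exists u, e u = e s + e t) ->
  (forall a t, exists u, e u = a *: e t) ->
  exists (Q : premodule R T) (i : {linear quot Q -> M}),
    injective i /\ forall t, i (qpi Q t) = e t.
Proof.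
move=> e0 eD eZ.
have eD' (p : T * T) : exists u, e u = e p.1 + e p.2 by apply: eD.
have eZ' (p : R * T) : exists u, e u = p.1 *: e p.2 by apply: eZ.
have [add addE] := choice eD'; have [scale scaleE] := choice eZ'.
unshelve epose (Q := @Premodule R T (fun s t => e s = e t) t0
  (fun s t => add (s, t)) (fun a t => scale (a, t)) _ _ _ _ _ _ _ _ _ _ _ _ _);
  rewrite /=.
- by [].
- by [].
- by move=> y x z -> ->.
- by move=> x x' y y' ex ey; rewrite ?addE /= ex ey.
- by move=> a x x' ex; rewrite ?scaleE /= ex.
- by move=> x y z; rewrite ?addE /= ?addE /= addrA.
- by move=> x y; rewrite ?addE /= addrC.
- by move=> x; rewrite ?addE /= e0 add0r.
- by move=> x; rewrite ?scaleE /= e0 scale0r.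
- by move=> a b x; rewrite ?scaleE /= ?scaleE /= scalerA.
- by move=> x; rewrite ?scaleE /= scale1r.
- by move=> a x y; rewrite ?(addE, scaleE) /= ?(addE, scaleE) /= scalerDr.
- by move=> x a b; rewrite ?(addE, scaleE) /= ?scaleE /= scalerDl.
have [||| i iE] := @quot_lift T Q M e.
- by [].
- by move=> x y /=; rewrite ?addE.
- by move=> a x /=; rewrite ?scaleE.
exists Q, i; split=> // p q.
rewrite -(qreprK p) -(qreprK q) !iE => E.
exact/qpi_eq.
Qed.

End LinearMaps.

(** * Purity and linear systems *)

Section Purity.
Variable R : pzRingType.
Implicit Types M N P : lmodType R.

(* [rim n m r x]: the first [n] entries of [x] form a tuple in r(M^m), for the
   n x m matrix r; that is, [x] vanishes in (R^n/r(R^m)) tensor M. *)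
Definition rim n m (r : nat -> nat -> R) M (x : nat -> M) : Prop :=
  exists y : nat -> M, forall j, (j < n)%N -> x j = \sum_(i < m) r j i *: y i.

Lemma eq_rim n m r M (x x' : nat -> M) : x =1 x' -> rim n m r x -> rim n m r x'.
Proof. by move=> /funext->. Qed.

Lemma rim_map n m r M N (f : {linear M -> N}) x :
  rim n m r x -> rim n m r (f \o x).
Proof.
move=> [y yE]; exists (f \o y) => j jn /=; rewrite yE// linear_sum.
by apply: eq_bigr => i _; rewrite linearZ.
Qed.

Lemma rimD n m r M (x x' : nat -> M) :
  rim n m r x -> rim n m r x' -> rim n m r (fun j => x j + x' j).
Proof.
move=> [y yE] [y' y'E]; exists (fun i => y i + y' i) => j jn.
rewrite yE// y'E// -big_split; apply: eq_bigr => i _ /=.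
by rewrite scalerDr.
Qed.

Lemma rimN n m r M (x : nat -> M) :
  rim n m r x -> rim n m r (fun j => - x j).
Proof.
move=> [y yE]; exists (fun i => - y i) => j jn.
by rewrite yE// -sumrN; apply: eq_bigr => i _; rewrite scalerN.
Qed.

Lemma rim0r r M (x : nat -> M) n :
  rim n 0 r x <-> forall j, (j < n)%N -> x j = 0.
Proof.
split=> [[y yE] j jn|E]; first by rewrite yE// big_ord0.
by exists (fun=> 0) => j jn; rewrite big_ord0 E.
Qed.

(** For linear [f], this is injectivity after tensoring with each group R^n/r(R^m). *)
Definition epure M N (f : M -> N) : Prop :=
  forall n m r x, rim n m r (f \o x) -> rim n m r x.

(** The 1 x 0 matrix gives the group R, and tensoring with R gives back [f]. *)
Lemma epure_inj M N (f : {linear M -> N}) : epure f -> injective f.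
Proof.
move=> pf x y fxy; have := pf 1 0 (fun _ _ => 0) (fun=> x - y).
rewrite !rim0r => /(_ _ 0 (ltnSn 0)) => E.
by apply/subr0_eq/E => j _ /=; rewrite linearB fxy subrr.
Qed.

Definition stdrow n j : 'rV[R]_n := \row_i (i == j :> nat)%:R.
Definition lincomb n M (y : nat -> M) (v : 'rV[R]_n) : M :=
  \sum_(i < n) v 0 i *: y i.
Definition coefs n (v : 'rV[R]_n) (i : nat) : R :=
  if insub i is Some o then v 0 o else 0.

Lemma coefsE n (v : 'rV[R]_n) (i : 'I_n) : coefs v i = v 0 i.
Proof. by rewrite /coefs valK. Qed.

Lemma lincomb_linear n M (y : nat -> M) : linear (@lincomb n M y).
Proof.
move=> a v w; rewrite /lincomb scaler_sumr -big_split; apply: eq_bigr => i _ /=.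
by rewrite !mxE scalerDl scalerA.
Qed.

Lemma lincomb_stdrow n M (y : nat -> M) j :
  (j < n)%N -> lincomb y (stdrow n j) = y j.
Proof.
move=> jn; rewrite /lincomb (bigD1 (Ordinal jn))//= mxE eqxx scale1r.
rewrite big1 ?addr0// => i ij.
by rewrite mxE (negbTE (ij : (i : nat) != j)) scale0r.
Qed.

Lemma row_sum_stdrow n (v : 'rV[R]_n) : v = \sum_(i < n) v 0 i *: stdrow n i.
Proof.
apply/rowP => k; rewrite summxE (bigD1 k)//= !mxE eqxx mulr1 big1 ?addr0//.
move=> i ik; rewrite !mxE; case: eqP => [/val_inj e|_]; last by rewrite mulr0.
by rewrite e eqxx in ik.
Qed.

Lemma linear_rowE n M (t : {linear 'rV[R]_n -> M}) v :
  t v = lincomb (fun i => t (stdrow n i)) v.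
Proof.
rewrite {1}(row_sum_stdrow v) linear_sum; apply: eq_bigr => i _.
by rewrite linearZ.
Qed.

Lemma eq_linear_row n M (t t' : {linear 'rV[R]_n -> M}) :
  (forall j, (j < n)%N -> t (stdrow n j) = t' (stdrow n j)) -> t =1 t'.
Proof.
move=> E v; rewrite !linear_rowE; apply: eq_bigr => i _.
by rewrite E.
Qed.

Lemma free_finitely_presented n : finitely_presented 'rV[R]_n.
Proof.
exists 0%N, n, (mklin (lincomb_linear (fun=> 0))), idfun; split.
  by move=> x; exists x.
move=> y; split=> /= [->|[z <-]]; last by rewrite /lincomb big_ord0.
by exists 0; rewrite /lincomb big_ord0.
Qed.

(** A solution [y] in [N] is a commutative square on free modules: [g] multiplies by the matrix, [u]
    and [v] send basis rows to [x] and [y]. The diagonal filler yields a solution in [M]. *)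
Lemma pure_epure M N (f : {linear M -> N}) : pure f -> epure f.
Proof.
move=> pf n m r x [y /= yE].
pose A := \matrix_(j < n, i < m) r j i.
have gl : linear (fun v : 'rV[R]_n => v *m A).
  by move=> a v w; rewrite mulmxDl scalemxAl.
have [v|t tE] := @pf _ _ (mklin gl) (mklin (lincomb_linear x))
  (mklin (lincomb_linear y)) (free_finitely_presented n)
  (free_finitely_presented m).
  rewrite /= /lincomb linear_sum.
  under eq_bigr => j _ do rewrite linearZ /= yE// scaler_sumr.
  rewrite exchange_big; apply: eq_bigr => i _ /=.
  rewrite mxE scaler_suml; apply: eq_bigr => j _.
  by rewrite mxE scalerA.
exists (fun i => t (stdrow m i)) => j jn.
have := tE (stdrow n j); rewrite [RHS]lincomb_stdrow//= => <-.
rewrite linear_rowE; apply: eq_bigr => i _; congr (_ *: _).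
rewrite mxE (bigD1 (Ordinal jn))//= !mxE eqxx mul1r big1 ?addr0// => k kj.
by rewrite mxE (negbTE (kj : (k : nat) != j)) mul0r.
Qed.

Lemma lin_descend M N P (p : {linear M -> N}) (f : {linear M -> P}) :
  (forall y, exists x, p x = y) -> (forall x, p x = 0 -> f x = 0) ->
  exists g : {linear N -> P}, forall x, g (p x) = f x.
Proof.
move=> /choice[s sK] kf; pose g y := f (s y).
have gE x : g (p x) = f x.
  apply: subr0_eq; rewrite -linearB; apply: kf.
  by rewrite linearB sK subrr.
have gl : linear g.
  by move=> a y z; rewrite -[y]sK -[z]sK -linearP !gE linearP.
by exists (mklin gl).
Qed.

(** The unknowns are the images in [M] of the [b] generators of [Y]. They must satisfy the relations
    of [Y] and agree with [u] on the generators of [X]; [v] solves this system in [N]. *)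
Lemma epure_pure M N (f : {linear M -> N}) : epure f -> pure f.
Proof.
move=> pf X Y g u v [_ [n [_ [pX [pXs _]]]]] [a [b [rho [pY [pYs pYk]]]]] fuv.
have [s sE] := choice (fun j : nat => pYs (g (pX (stdrow n j)))).
pose y i := v (pY (stdrow b i)).
have yE w : \sum_(i < b) coefs w i *: y i = v (pY w).
  have := linear_rowE (v \o pY : {linear _ -> _}) w => /= ->.
  by apply: eq_bigr => i _; rewrite coefsE.
(* The first [n] rows express [g] of the generators of [X]; the next [a] rows are the relations of
   [Y], with right-hand side 0. *)
pose q j := if (j < n)%N then s j else rho (stdrow a (j - n)).
pose x j := if (j < n)%N then u (pX (stdrow n j)) else 0.
have [|y' y'E] := pf (n + a)%N b (fun j i => coefs (q j) i) x.
  exists y => j _; rewrite yE /= /x /q; case: ifP => jn.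
    by rewrite sE -fuv.
  by rewrite (pYk _).2 ?linear0//; exists (stdrow a (j - n)).
pose T0 : {linear 'rV[R]_b -> M} := mklin (@lincomb_linear b M y').
have T0q j : (j < n + a)%N -> T0 (q j) = x j.
  move=> jn; rewrite y'E//; apply: eq_bigr => i _.
  by rewrite coefsE.
have [w|t tE] := lin_descend (f := T0) pYs.
  move=> /pYk[z <-].
  apply: (eq_linear_row (t := T0 \o rho : {linear _ -> _}) (t' := \0) _ z).
  move=> j ja; have := T0q (n + j)%N; rewrite ltn_add2l => /(_ ja).
  by rewrite /q /x ltnNge leq_addr /= addKn.
exists t => z; have [{}z <-] := pXs z; move: z.
apply: (eq_linear_row (t := t \o (g \o pX) : {linear _ -> _})
                      (t' := u \o pX : {linear _ -> _})) => j jn /=.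
have := T0q j (ltn_addr _ jn); rewrite /q /x jn => <-.
by rewrite -sE tE.
Qed.

Lemma mkpure M N (f : {linear M -> N}) : epure f ->
  exists g : pure_mono M N, forall x, g x = f x.
Proof. by move=> pf; exists (PureMono (epure_inj pf) (epure_pure pf)). Qed.

Lemma pure_monoP M N (f : pure_mono M N) : epure f.
Proof. exact/pure_epure/pm_pure. Qed.

End Purity.

(** * Pushouts and pure-effective squares *)

Section Pushout.
Variable R : pzRingType.
Implicit Types A B C D M X : lmodType R.

Lemma quotient_submodule M (N : M -> Prop) :
  N 0 -> (forall a x y, N x -> N y -> N (a *: x + y)) ->
  exists (Q : lmodType R) (p : {linear M -> Q}),
    (forall y, exists x, p x = y) /\ (forall x, p x = 0 <-> N x).
Proof.
move=> N0 NP.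
have NZ a x : N x -> N (a *: x) by move=> Nx; rewrite -[_ *: _]addr0; apply: NP.
have ND x y : N x -> N y -> N (x + y).
  by move=> Nx Ny; rewrite -[x]scale1r; apply: NP.
have NN x : N x -> N (- x) by rewrite -scaleN1r; apply: NZ.
unshelve epose (Q := @Premodule R M (fun x y => N (x - y)) 0 +%R *:%R
  _ _ _ _ _ _ _ _ _ _ _ _ _); rewrite /=.
- by move=> x; rewrite subrr.
- by move=> x y /NN; rewrite opprB.
- by move=> y x z Nxy /(ND _ _ Nxy); rewrite addrA subrK.
- by move=> x x' y y' Nx /(ND _ _ Nx); rewrite opprD addrACA.
- by move=> a x y /(NZ a); rewrite scalerBr.
- by move=> x y z; rewrite addrA subrr.
- by move=> x y; rewrite (addrC y) subrr.
- by move=> x; rewrite add0r subrr.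
- by move=> x; rewrite scale0r subrr.
- by move=> a b x; rewrite scalerA subrr.
- by move=> x; rewrite scale1r subrr.
- by move=> a x y; rewrite scalerDr subrr.
- by move=> x a b; rewrite scalerDl subrr.
have pl : linear (qpi Q).
  by move=> a x y; rewrite -qpiZ -qpiD.
exists (quot Q), (mklin pl); split; first exact: qpi_surj.
move=> x /=; split=> [|Nx].
  rewrite -(linear0 (mklin pl)) => /qpi_eq /=; by rewrite subr0.
rewrite -(linear0 (mklin pl)); apply/qpi_eq => /=; by rewrite subr0.
Qed.

(* Independence: for every finite matrix r, the square of the groups
   (R^n/r(R^m)) tensor _ meets the pullback condition.  When all four maps are
   pure monomorphisms, this says that the map from the pushout of f and g to D
   is a pure monomorphism. *)
Definition meets A B C D (f : A -> B) (g : A -> C) (h : B -> D) (k : C -> D) :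
    Prop :=
  forall n m r (b : nat -> B) (c : nat -> C),
    rim n m r (fun j => h (b j) - k (c j)) ->
    exists a : nat -> A, rim n m r (fun j => b j - f (a j)) /\
                         rim n m r (fun j => c j - g (a j)).

Definition effective A B C D (f : A -> B) (g : A -> C) (h : B -> D)
  (k : C -> D) : Prop := (forall x, h (f x) = k (g x)) /\ meets f g h k.

Lemma pushout X B C (f : {linear X -> B}) (g : {linear X -> C}) :
  exists (D : lmodType R) (h : {linear B -> D}) (k : {linear C -> D}),
    effective f g h k.
Proof.
have [||D [p [ps pk]]] :=
    @quotient_submodule (B * C)%type (fun z => exists x, z = (f x, - g x)).
- by exists 0; rewrite !linear0 ?oppr0.
- move=> a z z' [x ->] [x' ->]; exists (a *: x + x').
  by rewrite !linearP.
have hl : linear (fun b => p (b, 0)).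
  move=> a b b'; rewrite -linearP; congr (p _).
  by congr (_, _); rewrite /= scaler0 addr0.
have kl : linear (fun c => p (0, c)).
  move=> a c c'; rewrite -linearP; congr (p _).
  by congr (_, _); rewrite /= scaler0 addr0.
exists D, (mklin hl), (mklin kl).
have hkE b c : p (b, 0) - p (0, c) = p (b, - c).
  by rewrite -linearB; congr (p _); congr (_, _); rewrite /= ?subr0 ?sub0r.
split=> [x|n m r b c [y yE]].
  by apply: subr0_eq; rewrite /= hkE; apply/pk; exists x.
(* Lifted to [B * C], the relation holds in each row up to some [(f x, - g x)]; its two coordinates
   give the two conclusions. *)
have [w wE] := choice (fun i => ps (y i)).
have [j|x xE] := choice (P := fun j x => (j < n)%N ->
    (b j, - c j) - \sum_(i < m) r j i *: w i = (f x, - g x)).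
  case: (ltnP j n) => jn; last by exists 0.
  have [x xE] : exists x,
      (b j, - c j) - \sum_(i < m) r j i *: w i = (f x, - g x).
    apply/pk; rewrite linearB -hkE; have /= -> := yE j jn.
    rewrite linear_sum -sumrB big1// => i _.
    by rewrite linearZ wE subrr.
  by exists x.
exists x; split.
  exists (fst \o w) => j jn.
  have /(congr1 fst) /= <- := xE j jn.
  rewrite opprB addrC subrK (linear_sum (@fst B C)).
  by apply: eq_bigr.
exists (fun i => - (w i).2) => j jn.
have /(congr1 snd) /= E := xE j jn.
rewrite -E addrA subrr sub0r (linear_sum (@snd B C)) -sumrN.
by apply: eq_bigr => i _; rewrite scalerN.
Qed.

Lemma effective_sym A B C D (f : A -> B) (g : A -> C) (h : B -> D)
    (k : C -> D) : effective f g h k -> effective g f k h.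
Proof.
move=> [e H]; split=> [x|n m r c b /rimN kb]; first by rewrite e.
have [|a [? ?]] := H n m r b c; last by exists a.
by apply: eq_rim kb => j; rewrite opprB.
Qed.

(** With [c = 0], the pullback condition gives [b = f a] and [g a = 0] in the tensor product, and
    the hypothesis turns the latter into [f a = 0]. *)
Lemma effective_epure A B C D (f : {linear A -> B}) (g : {linear A -> C})
    (h : {linear B -> D}) (k : {linear C -> D}) :
  (forall n m r x, rim n m r (g \o x) -> rim n m r (f \o x)) ->
  effective f g h k -> epure h.
Proof.
move=> gf [_ H] n m r b hb.
have [|a [ba ga]] := H n m r b (fun=> 0).
  by apply: eq_rim hb => j; rewrite linear0 subr0.
have fa : rim n m r (f \o a).
  by apply: gf; have := rimN ga; apply: eq_rim => j /=; rewrite sub0r opprK.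
by have := rimD ba fa; apply: eq_rim => j /=; rewrite subrK.
Qed.

(** Asking only for equal kernels after tensoring covers both a span of pure maps and the maps out
    of [B * C] that occur in uniqueness. *)
Lemma pushout_pure X B C (f : {linear X -> B}) (g : {linear X -> C}) :
  (forall n m r x, rim n m r (f \o x) <-> rim n m r (g \o x)) ->
  exists (D : lmodType R) (h : pure_mono B D) (k : pure_mono C D),
    effective f g h k.
Proof.
move=> fg; have [D [h [k hk]]] := pushout f g.
have [h' h'E] := mkpure (effective_epure (fun n m r x => (fg n m r x).2) hk).
have [k' k'E] := mkpure (effective_epure (fun n m r x => (fg n m r x).1)
  (effective_sym hk)).
have eh : h' = h :> (B -> D) by apply/funext.
have ek : k' = k :> (C -> D) by apply/funext.
by exists D, h', k'; rewrite eh ek.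
Qed.

Lemma epure_rim M X (f : {linear M -> X}) n m r x :
  epure f -> rim n m r (f \o x) <-> rim n m r x.
Proof. by move=> pf; split=> [/pf|/(rim_map f)]. Qed.

Definition effective_squares : independence (RMod_pure R).
Proof.
refine (@Independence (RMod_pure R)
  (fun (A B C D : lmodType R) (f : pure_mono A B) (g : pure_mono A C)
       (h : pure_mono B D) (k : pure_mono C D) => effective f g h k) _ _).
- by move=> A B C D f g h k [e _]; apply: pure_mono_eq => x; apply: e.
- move=> A B C D E f g h k t.
  move/(congr1 (fun u : pure_mono A D => u : A -> D)) => /= e.
  split=> -[_ H]; split.
  + by move=> x; have := congr1 (fun u => t (u x)) e.
  + move=> n m r b c /= tbc; apply: H; apply: (pure_monoP (f := t)).
    by apply: eq_rim tbc => j /=; rewrite linearB.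
  + by move=> x; have := congr1 (fun u => u x) e.
  + move=> n m r b c bc; apply: H; have := rim_map (pm_fun t) bc.
    by apply: eq_rim => j /=; rewrite linearB.
Defined.

(** Transitivity pastes pullbacks and existence is the pushout. For uniqueness, [E] is the pushout
    of the two maps from [B * C] to [D1] and [D2]. *)
Lemma effective_squares_weakly_stable : weakly_stable effective_squares.
Proof.
have trans (A B C D B' D' : lmodType R) (f : pure_mono A B) (g : pure_mono A C)
    (h : pure_mono B D) (k : pure_mono C D) (f' : pure_mono B B')
    (h' : pure_mono B' D') (k' : pure_mono D D') :
    effective f g h k -> effective f' h h' k' ->
    effective (f' \o f) g h' (k' \o k).
  move=> [e H] [e' H']; split=> [x|n m r b' c bc] /=; first by rewrite e' e.
  have [b [b'b cb]] := H' _ _ _ _ _ bc.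
  have [|a [ba ca]] := H n m r b c.
    by have := rimN cb; apply: eq_rim => j; rewrite opprB.
  exists a; split=> //; have := rimD b'b (rim_map (pm_fun f') ba).
  by apply: eq_rim => j /=; rewrite linearB addrA subrK.
split.
- by move=> A B C D f g h k; apply: effective_sym.
- by move=> A B C D B' D' f g h k f' h' k'; apply: trans.
- move=> A B C D C' D' f g h k g' h' k' H H'.
  apply/effective_sym; apply: (trans _ _ _ _ _ _ g f k h g' k' h').
    exact: effective_sym H.
  exact: effective_sym H'.
- move=> A B C f g.
  have [|D [h [k hk]]] := @pushout_pure A B C (pm_fun f) (pm_fun g).
    move=> n m r x; rewrite (epure_rim _ _ _ _ (pure_monoP (f := f))).
    by rewrite (epure_rim _ _ _ _ (pure_monoP (f := g))).
  by exists D, h, k.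
move=> A B C D1 D2 f g h1 k1 h2 k2 [e1 H1] [e2 H2].
pose jl (D : lmodType R) (h : pure_mono B D) (k : pure_mono C D)
  (z : (B * C)%type) := h z.1 + k z.2.
have jlP D h k : linear (jl D h k).
  by move=> a z z'; rewrite /jl !linearP /= scalerDr addrACA.
(* A pair vanishing in [D] is [(f a, - g a)] up to vanishing terms, so it vanishes in [D'] too. *)
have aux D D' (h : pure_mono B D) (k : pure_mono C D) (h' : pure_mono B D')
    (k' : pure_mono C D') n m r (z : nat -> (B * C)%type) :
    effective f g h k -> effective f g h' k' ->
    rim n m r (mklin (jlP D h k) \o z) -> rim n m r (mklin (jlP D' h' k') \o z).
  move=> [e H] [e' H'] hz.
  have [|a [ba ca]] := H n m r (fun j => (z j).1) (fun j => - (z j).2).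
    by apply: eq_rim hz => j; rewrite linearN opprK.
  have := rimD (rim_map (pm_fun h') ba) (rimN (rim_map (pm_fun k') ca)).
  apply: eq_rim => j /=.
  rewrite (linearB (pm_fun h')) (linearB (pm_fun k')) (linearN (pm_fun k')).
  by rewrite e' -opprD opprK addrACA addNr addr0.
have [|E [t1 [t2 [e _]]]] :=
    @pushout_pure _ _ _ (mklin (jlP D1 h1 k1)) (mklin (jlP D2 h2 k2)).
  by move=> n m r z; split; apply: aux.
exists E, t1, t2; split; apply: pure_mono_eq => x /=.
  have := e (x, 0); by rewrite /= /jl /= !linear0 !addr0.
have := e (0, x); by rewrite /= /jl /= !linear0 !add0r.
Qed.

End Pushout.

(** * Cardinals *)

Lemma card_le_injP (T U : Type) :
  [set: T] #<= [set: U] <-> exists f : T -> U, injective f.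
Proof.
split=> [|[f fI]].
  case: (pselectT T) => [T0 _|t].
    by exists (fun x => False_rect _ (T0 x)).
  elim/Ppointed: U => U.
    by rewrite !emptyE => /seteqP[/(_ t I)].
  move=> /pcard_injP[f fI]; exists f => x y; apply: fI; exact: in_setT.
have := inj_card_eq (A := setT) (in2W fI).
rewrite card_eq_sym card_eq_le => /andP[/card_le_trans + _]; apply.
exact: subset_card_le.
Qed.

Lemma no_card_le_powerset (K : Type) : ~ ([set: set K] #<= [set: K]).
Proof.
move=> /card_le_injP[f fI].
pose D : set K := fun k => exists2 S : set K, f S = k & ~ S k.
have nD : ~ D (f D) by move=> [S /fI ->] nD; apply: (nD); exists D.
by apply: (nD); exists D.
Qed.

Lemma exists_well_order (T : Type) : exists lt : T -> T -> Prop,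
  [/\ well_founded lt, forall x y z, lt x y -> lt y z -> lt x z &
      forall x y, x <> y -> lt x y \/ lt y x].
Proof.
have [le leP] := well_ordering_principle {classic T}.
have tot : total le.
  by have := @wo_chainW _ le predT (withinW leP) => H x y; apply: H.
have anti : antisymmetric le.
  have := @wo_chain_antisymmetric _ le predT (withinW leP) => H x y; exact: H.
exists (fun x y : T => le x y /\ x <> y); split.
- move=> x; apply: contrapT => nx.
  (* A least inaccessible element would have only accessible predecessors. *)
  pose A : {pred {classic T}} :=
    fun y => `[< ~ Acc (fun x y : T => le x y /\ x <> y) y >].
  have [|z [[/asboolP zA zmin] _]] := leP A; first by exists x; apply/asboolP.
  apply: zA; constructor=> y [yz ny]; apply: contrapT => nA.
  have zy := zmin y (introT (asboolP _) nA).
  by apply: ny; apply: anti; rewrite yz zy.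
- move=> x y z [xy nxy] [yz nyz]; have xz : le x z.
    have [//|zx] := orP (tot x z).
    have [|w [[wA wmin] _]] :=
      leP [pred w : {classic T} | [|| w == x, w == y | w == z]].
      by exists x; rewrite !inE eqxx.
    have wx := wmin x; have wy := wmin y; have wz := wmin z.
    rewrite !inE !eqxx /= ?orbT in wx wy wz.
    case/or3P: wA => /eqP ew; rewrite ew in wx wy wz.
    + exact: wz.
    + by case: nxy; apply: anti; rewrite xy wx.
    + by case: nyz; apply: anti; rewrite yz wy.
  split=> // e; rewrite -e in yz; apply: nxy; apply: anti.
  by rewrite xy yz.
- move=> x y nxy; have [xy|yx] := orP (tot x y); first by left.
  by right; split=> // /esym.
Qed.

(** [L] is an initial segment of the well-ordered powerset of [K] that does not embed in [K] while
    its proper segments do. A set [A] is compared with [L] by listing [A] along the order. *)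
Lemma successor_cardinal (K : small) : exists L : small,
  ~ ([set: L] #<= [set: K]) /\
  forall (X : small) (A : set X), ~ ([set: L] #<= A) -> A #<= [set: K].
Proof.
have [lt [ltw ltT lt_tot]] := exists_well_order (set K).
pose seg w := [set v | lt v w].
have [S [Sdown SK segK]] : exists S : set (set K),
    [/\ forall v w, lt v w -> S w -> S v, ~ (S #<= [set: K]) &
        forall w, S w -> seg w #<= [set: K]].
  have [sK|/existsNP[w0]] := pselect (forall w, seg w #<= [set: K]).
    by exists setT; split=> //; apply: no_card_le_powerset.
  elim/(well_founded_ind ltw): w0 => w IH wK.
  have [[v [vw vK]]|nv] := pselect (exists v, lt v w /\ ~ (seg v #<= [set: K])).
    exact: IH vK.
  exists (seg w); split=> // [u v uv vw|v vw]; first exact: ltT vw.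
  by apply: contrapT => vK; apply: nv; exists v.
exists {w | S w}; split.
  apply: contra_not SK; apply: card_le_trans.
  have SE : S `<=` @sval _ _ @` [set: {w | S w}].
    by move=> w Sw; exists (exist _ w Sw).
  exact: card_le_trans (subset_card_le SE) (card_image_le _ _).
move=> X A nLA.
(* The recursion picks an element of [A] not picked before, or [None] once [A] is exhausted. *)
pose step (w : set K) (rec : forall v, lt v w -> option X) : option X :=
  match pselect (exists a, A a /\ forall v (p : lt v w), rec v p <> Some a) with
  | left h => Some (sval (cid h))
  | right _ => None
  end.
pose f : set K -> option X := Fix ltw (fun _ => option X) step.
have fE w : f w = step w (fun v _ => f v).
  apply: (Fix_eq ltw (fun _ => option X) step) => x g g' gg'.
  by congr step; apply: functional_extensionality_dep => y; apply/funext.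
have fS w a : f w = Some a -> A a /\ forall v, lt v w -> f v <> Some a.
  rewrite fE /step; case: pselect => // h [<-].
  by have [] := svalP (cid h).
have fN w : f w = None -> forall a, A a -> exists2 v, lt v w & f v = Some a.
  rewrite fE /step; case: pselect => // h _ a Aa.
  apply: contrapT => nv; apply: h; exists a; split=> // v vw fv.
  by apply: nv; exists v.
(* Either [A] is exhausted at some [w] in [S], and the segment below [w] covers it, or [f] embeds
   [L] in [A]. *)
have [[w [Sw fw]]|nN] := pselect (exists w, S w /\ f w = None).
  apply: card_le_trans (segK w Sw).
  have : some @` A `<=` f @` seg w.
    by move=> _ [a Aa <-]; have [v vw fv] := fN w fw a Aa; exists v.
  move=> /subset_card_le/card_le_trans/(_ (card_image_le _ _)).
  by rewrite (card_le_eql card_some).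
case: nLA.
have g (w : {w | S w}) : exists a, f (sval w) = Some a.
  case: w => w Sw /=; case fw: (f w) => [a|]; first by exists a.
  by case: nN; exists w.
have [h hE] := choice g.
have hI : injective h.
  move=> [u Su] [v Sv] e; apply: eq_exist => /=; apply: contrapT => nuv.
  have := hE (exist _ u Su); have := hE (exist _ v Sv).
  rewrite /= e => fv fu.
  by have [uv|vu] := lt_tot _ _ nuv; [have [_ /(_ _ uv)] := fS _ _ fv |
                                      have [_ /(_ _ vu)] := fS _ _ fu].
have := inj_card_eq (A := setT) (in2W hI).
rewrite card_eq_sym card_eq_le => /andP[/card_le_trans + _]; apply.
by apply: subset_card_le => _ [w _ <-]; have [] := fS _ _ (hE w).
Qed.

(** * The cardinal kappa and its successor *)

Section Kappa.
Variable R : pzRingType.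

(* A cardinal bounding aleph_0 and the cardinality of R, and equal to its own
   aleph_0-th power. *)
Definition kappa : small := nat -> nat * R.

(** One element of [kappa] stores a whole sequence of elements of [kappa]: this makes kappa^aleph_0
    = kappa explicit. *)
Definition kproj (i : nat) (c : kappa) : kappa := fun k => c (pickle (i, k)).

Lemma kproj_surj (t : nat -> kappa) : exists c, forall i, kproj i c = t i.
Proof.
exists (fun n => if unpickle n is Some (i, k) then t i k else (0%N, 0)) => i.
by apply/funext => k; rewrite /kproj pickleK.
Qed.

Lemma kproj_pair (c d : kappa) : exists e, kproj 0 e = c /\ kproj 1 e = d.
Proof.
have [e eE] := kproj_surj (fun i => if i is 0 then c else d).
by exists e; rewrite !eE.
Qed.

Lemma card_nat_kappa : [set: nat] #<= [set: kappa].
Proof.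
apply/card_le_injP; exists (fun n _ => (n, 0)) => m n.
by move=> /(congr1 (fun c => (c 0%N).1)).
Qed.

Lemma card_sig_kappa (I : small) (X : I -> small) :
  [set: I] #<= [set: kappa] -> (forall i, [set: X i] #<= [set: kappa]) ->
  [set: {i : I & X i}] #<= [set: kappa].
Proof.
move=> /card_le_injP[f fI] Xk.
have {}Xk i : exists g : X i -> kappa, injective g by apply/card_le_injP/Xk.
pose g i := sval (cid (Xk i)).
have [p pE] := choice (fun s : {i & X i} =>
  kproj_pair (f (tag s)) (g (tag s) (tagged s))).
apply/card_le_injP; exists p => -[i x] [j y] e.
have := pE (existT _ i x); have := pE (existT _ j y); rewrite e /= => -[-> ->].
case=> /fI ij; subst j => gxy; congr existT.
exact: (svalP (cid (Xk i))).
Qed.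

(** The successor of kappa is regular because a sum of at most kappa types of size at most kappa
    again has size at most kappa. *)
Lemma exists_kappa_successor : exists L : small,
  [/\ regular_cardinal L, ~ ([set: L] #<= [set: kappa]) &
  forall (X : small) (A : set X), ~ ([set: L] #<= A) -> A #<= [set: kappa]].
Proof.
have [L [Lk LA]] := successor_cardinal kappa; exists L; split=> //; split.
  apply/infiniteP => Lfin; apply: Lk; apply: card_le_trans card_nat_kappa.
  exact/finite_set_countable.
move=> I X LI LX; apply: contra_not Lk => /card_le_trans; apply.
by apply: card_sig_kappa => [|i]; [exact: LA | exact: LA].
Qed.

End Kappa.

(** * Directed systems of modules *)

Section System.
Variables (R : pzRingType) (P : poset) (i0 : P).
Hypothesis ub : forall F : nat -> P, exists k, forall n, ple (F n) k.
Variables (M : P -> lmodType R)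
  (t : forall i j, ple i j -> {linear M i -> M j}).
Hypothesis tt : forall i j k (p : ple i j) (q : ple j k) (r : ple i k) x,
  t r x = t q (t p x).

Definition compatible (T : Type) (c : forall i, M i -> T) : Prop :=
  forall i j (p : ple i j) x, c j (t p x) = c i x.
Definition jointly_surjective (T : Type) (c : forall i, M i -> T) : Prop :=
  forall y, exists i x, c i x = y.

Lemma ub2 (i j : P) : exists k, ple i k /\ ple j k.
Proof.
have [k kP] := ub (fun n => if n is 0 then i else j).
by exists k; split; [exact: (kP 0%N) | exact: (kP 1%N)].
Qed.

(** Bounds for countable families place a whole sequence, hence any witness of [rim], at one
    stage. *)
Lemma lift_sequence (T : Type) (c : forall i, M i -> T) i (x : nat -> T) :
  compatible c -> jointly_surjective c ->
  exists k, ple i k /\ exists x' : nat -> M k, forall n, c k (x' n) = x n.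
Proof.
move=> cc cs; have [F FE] := choice (fun n => cs (x n)).
have [k0 k0P] := ub F; have [k [ik kP]] := ub2 i k0; exists k; split=> //.
have x'P n : exists y, c k y = x n.
  have [y <-] := FE n; exists (t (ple_trans (k0P n) kP) y); exact: cc.
by have [x' x'E] := choice x'P; exists x'.
Qed.

Lemma directed_descend (C N : lmodType R) (c : forall i, {linear M i -> C})
    (d : forall i, {linear M i -> N}) :
  compatible c -> jointly_surjective c -> (forall i, injective (c i)) ->
  compatible d ->
  exists v : {linear C -> N}, forall i x, v (c i x) = d i x.
Proof.
move=> cc cs cI dd.
have wd i j x y : c i x = c j y -> d i x = d j y.
  have [k [ik jk]] := ub2 i j; rewrite -(cc _ _ ik) -(cc _ _ jk) => /cI e.
  by rewrite -(dd _ _ ik) e dd.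
have [v vP] : {v : C -> N & forall y, exists i x, c i x = y /\ d i x = v y}.
  apply: (choice (P := fun y v => exists i x, c i x = y /\ d i x = v)) => y.
  have [i [x xy]] := cs y.
  by exists (d i x), i, x.
have vE i x : v (c i x) = d i x.
  by have [j [y [/wd <- ->]]] := vP (c i x).
suff vl : linear v by exists (mklin vl).
move=> a y z.
have [k [_ [w wE]]] :=
  lift_sequence i0 (fun n => if n is 0 then y else z) cc cs.
have /= <- := wE 0%N; have /= <- := wE 1%N.
by rewrite -linearP !vE linearP.
Qed.

(** A solution in [C] comes from one stage [k] and is a solution there, as [c k] is injective: the
    tensor products commute with the colimit. *)
Lemma rim_stage (C : lmodType R) (c : forall i, {linear M i -> C}) i n m r
    (x : nat -> M i) :
  compatible c -> jointly_surjective c -> (forall i, injective (c i)) ->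
  rim n m r (c i \o x) -> exists k (p : ple i k), rim n m r (t p \o x).
Proof.
move=> cc cs cI [y yE].
have [k [ik [y' y'E]]] := lift_sequence i y cc cs.
exists k, ik, y' => j jn; apply: (cI k) => /=.
rewrite cc; have /= -> := yE j jn.
by rewrite linear_sum; apply: eq_bigr => l _; rewrite linearZ y'E.
Qed.

Hypothesis tI : forall i j (p : ple i j), injective (t p).

Lemma directed_colimit :
  exists (C : lmodType R) (c : forall i, {linear M i -> C}),
  [/\ compatible c, jointly_surjective c & forall i, injective (c i)].
Proof.
have [u uP] : {u : P * P -> P & forall p, ple p.1 (u p) /\ ple p.2 (u p)}.
  exact: (choice (fun p => ub2 p.1 p.2)).
have uL i j : ple i (u (i, j)) by have [] := uP (i, j).
have uR i j : ple j (u (i, j)) by have [] := uP (i, j).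
pose T : small := {i & M i}.
(* Agreement is asked at every common bound; by injectivity of the transition maps, one bound
   suffices ([eqvI]). *)
pose eqv (x y : T) := forall k (p : ple (tag x) k) (q : ple (tag y) k),
  t p (tagged x) = t q (tagged y).
have eqvI (x y : T) k (p : ple (tag x) k) (q : ple (tag y) k) :
    t p (tagged x) = t q (tagged y) -> eqv x y.
  move=> e l p' q'; have [h [kh lh]] := ub2 k l.
  apply: (tI (p := lh)); rewrite -(tt _ _ (ple_trans p kh)) (tt p kh) e.
  by rewrite -(tt _ _ (ple_trans q kh)) (tt q' lh).
pose add (x y : T) : T :=
  existT M _ (t (uL _ (tag y)) (tagged x) + t (uR (tag x) _) (tagged y)).
pose scale a (x : T) : T := existT M _ (a *: tagged x).
pose zero : T := existT M i0 0.
have addE x y k (p : ple (tag (add x y)) k) (px : ple (tag x) k)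
    (py : ple (tag y) k) :
    t p (tagged (add x y)) = t px (tagged x) + t py (tagged y).
  by rewrite /= linearD -!tt.
have scaleE a x k (p : ple (tag (scale a x)) k) :
  t p (tagged (scale a x)) = a *: t p (tagged x) by rewrite linearZ.
have zeroE k (p : ple (tag zero) k) : t p (tagged zero) = 0 by rewrite linear0.
have addL x y k : ple (tag (add x y)) k -> ple (tag x) k.
  by move=> p; apply: ple_trans p; apply: uL.
have addR x y k : ple (tag (add x y)) k -> ple (tag y) k.
  by move=> p; apply: ple_trans p; apply: uR.
pose Q := @Premodule R T eqv zero add scale.
have eqv_sym x y : eqv x y -> eqv y x by move=> e k p q; rewrite -(e k q p).
have eqv_refl x : eqv x x.
  by move=> k p q; congr (t _ _); apply: Prop_irrelevance.
have eqv_trans y x z : eqv x y -> eqv y z -> eqv x z.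
  move=> xy yz; have [k [xk yk]] := ub2 (tag x) (tag y).
  have [h [kh zh]] := ub2 k (tag z).
  apply: (eqvI _ _ _ (ple_trans xk kh) zh).
  rewrite (xy _ _ (ple_trans yk kh)); exact: yz.
have {}Q : exists Q : premodule R T,
    [/\ peq Q = eqv, padd Q = add & pscale Q = scale].
  unshelve eexists (Q _ _ _ _ _ _ _ _ _ _ _ _ _); rewrite ?{}/Q //.
  - move=> x x' y y' xx yy k p q.
    rewrite (addE _ _ _ p (addL _ _ _ p) (addR _ _ _ p)).
    rewrite (addE _ _ _ q (addL _ _ _ q) (addR _ _ _ q)).
    by rewrite (xx _ _ (addL _ _ _ q)) (yy _ _ (addR _ _ _ q)).
  - by move=> a x x' xx k p q; rewrite !scaleE (xx _ _ q).
  - move=> x y z k p q.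
    have px := addL _ _ _ p; have pyz := addR _ _ _ p.
    have py := addL _ _ _ pyz; have pz := addR _ _ _ pyz.
    have qxy := addL _ _ _ q.
    rewrite (addE _ _ _ p px pyz) (addE _ _ _ pyz py pz).
    by rewrite (addE _ _ _ q qxy pz) (addE _ _ _ qxy px py) addrA.
  - move=> x y k p q; have px := addL _ _ _ p; have py := addR _ _ _ p.
    by rewrite (addE _ _ _ p px py) (addE _ _ _ q py px) addrC.
  - move=> x k p q; rewrite (addE _ _ _ p (addL _ _ _ p) q).
    by rewrite zeroE add0r.
  - by move=> x k p q; rewrite scaleE zeroE scale0r.
  - move=> a b x k p q; rewrite (scaleE (a * b) x k q) -scalerA.
    rewrite (scaleE a (scale b x) k p); congr (_ *: _).
    rewrite (scaleE b x k p); congr (_ *: t _ _); exact: Prop_irrelevance.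
  - move=> x k p q; rewrite scaleE scale1r; congr (t _ _).
    exact: Prop_irrelevance.
  - move=> a x y k p q; have px := addL _ _ _ p; have py := addR _ _ _ p.
    rewrite scaleE (addE x y _ p px py) (addE _ _ _ q px py) !scaleE.
    by rewrite scalerDr.
  - move=> x a b k p q; rewrite scaleE (addE _ _ _ q p p) !scaleE.
    by rewrite scalerDl.
have [Q0 [Qe Qa Qs]] := Q.
have cl i : linear (fun x => qpi Q0 (existT M i x)).
  move=> a x y; rewrite -qpiZ -qpiD; apply/qpi_eq; rewrite Qe Qa Qs => k p q.
  rewrite (addE _ _ _ q p p) !scaleE /= linearP; congr (_ + _).
exists (quot Q0), (fun i => mklin (cl i)); split.
- move=> i j p x /=; apply/qpi_eq; rewrite Qe => k q r /=.
  by rewrite -tt.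
- by move=> y; have [[i x] <-] := qpi_surj y; exists i, x.
- move=> i x y /= /qpi_eq; rewrite Qe => e.
  have ii := ple_refl i.
  by apply: (tI (p := ii)); apply: e.
Qed.

End System.

(** * The category of pure monomorphisms and effective squares *)

Section Down.
Variable R : pzRingType.
Local Notation Sq := (effective_squares R).
Local Notation Dn := (down (effective_squares_weakly_stable R)).
Implicit Types f g : arrow (RMod_pure R).

(** These retype the parts of arrows and squares as modules and pure monomorphisms, so that their
    linear structure is found. *)
Definition dsrc f : lmodType R := src f.
Definition dtgt f : lmodType R := tgt f.
Definition dfun f : pure_mono (dsrc f) (dtgt f) := arr f.
Definition fsrc f g (s : indep_square Sq f g) : pure_mono (dsrc f) (dsrc g) :=
  sq_src s.
Definition ftgt f g (s : indep_square Sq f g) : pure_mono (dtgt f) (dtgt g) :=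
  sq_tgt s.

Lemma fsqP f g (s : indep_square Sq f g) :
  effective (dfun f) (fsrc s) (ftgt s) (dfun g).
Proof. exact: sq_indep s. Qed.

Lemma fsqE f g (s : indep_square Sq f g) x :
  dfun g (fsrc s x) = ftgt s (dfun f x).
Proof. by have [->] := fsqP s. Qed.

Lemma eq_down f g (s t : indep_square Sq f g) : ftgt s =1 ftgt t -> s = t.
Proof.
move=> e; apply: indep_square_eq; apply: pure_mono_eq => x; last exact: e.
by apply: (pm_inj (p := dfun g)); rewrite !fsqE e.
Qed.

Lemma ftgt_comp (f g h : Dn) (t : mor g h) (s : mor f g) x :
  ftgt (t ∘ s)%cat x = ftgt t (ftgt s x).
Proof. by []. Qed.

Lemma down_monic (f g h : Dn) (t : mor g h) (s s' : mor f g) :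
  (t ∘ s = t ∘ s')%cat -> s = s'.
Proof.
move=> e; apply: eq_down => x; apply: (pm_inj (p := ftgt t)).
by rewrite -!ftgt_comp e.
Qed.

(** Purity of [u] follows from that of [v] and [dfun f], since [dfun g \o u] equals
    [v \o dfun f]. *)
Lemma mkdown f g (u : {linear dsrc f -> dsrc g})
    (v : {linear dtgt f -> dtgt g}) :
  epure v -> effective (dfun f) u v (dfun g) ->
  exists s : indep_square Sq f g, ftgt s =1 v.
Proof.
move=> pv uv.
have pu : epure u.
  move=> n m r x ux; have := rim_map (pm_fun (dfun g)) ux => gux.
  apply: (pure_monoP (f := dfun f)); apply: pv.
  by apply: eq_rim gux => j /=; rewrite uv.1.
have [u' /funext u'E] := mkpure pu; have [v' /funext v'E] := mkpure pv.
have uv' : effective (dfun f) u' v' (dfun g) by rewrite u'E v'E.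
by exists (@IndepSquare _ Sq f g u' v' uv') => x; rewrite -v'E.
Qed.

(** The 1 x 0 matrix turns the tensored condition into one on the square itself. *)
Lemma effective_pullback (A B C D : lmodType R) (f : A -> B) (g : A -> C)
    (h : B -> D) (k : C -> D) b c :
  effective f g h k -> h b = k c -> exists a, b = f a /\ c = g a.
Proof.
move=> [_ H] e; have [|a] := H 1%N 0%N (fun _ _ => 0) (fun=> b) (fun=> c).
  by apply/rim0r => j _; rewrite e subrr.
rewrite !rim0r => -[/(_ _ (ltnSn 0))/subr0_eq -> /(_ _ (ltnSn 0))/subr0_eq ->].
by exists (a 0%N).
Qed.

(** Independent squares are pullbacks, so inclusion of target images forces inclusion of source
    images and both sides of [s] factor. Independence comes from that of [s] and purity of
    [fsrc t]. *)
Lemma down_factor (f g h : Dn) (s : mor f h) (t : mor g h) :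
  (forall x, exists y, ftgt t y = ftgt s x) ->
  exists u : mor f g, (t ∘ u)%cat = s.
Proof.
move=> st.
have st' x : exists y, fsrc t y = fsrc s x.
  have [y yE] := st (dfun f x); rewrite -fsqE in yE.
  by have [a [_ ->]] := effective_pullback (fsqP t) yE; exists a.
have [v vE] := lin_factor (pm_inj (p := ftgt t)) st.
have [u uE] := lin_factor (pm_inj (p := fsrc t)) st'.
have pv : epure v.
  move=> n m r x vx; apply: (pure_monoP (f := ftgt s)).
  have := rim_map (pm_fun (ftgt t)) vx; apply: eq_rim => j /=; exact: vE.
have [|w wE] := @mkdown f g u v pv.
  split=> [x|n m r b c bc].
    by apply: (pm_inj (p := ftgt t)); rewrite vE -[RHS]fsqE uE -fsqE.
  have [|a [ba ca]] := (fsqP s).2 n m r b (fsrc t \o c).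
    have := rim_map (pm_fun (ftgt t)) bc; apply: eq_rim => j /=.
    by rewrite linearB vE fsqE.
  exists a; split=> //; apply: (pure_monoP (f := fsrc t)).
  by apply: eq_rim ca => j /=; rewrite linearB uE.
by exists w; apply: eq_down => x; rewrite ftgt_comp wE vE.
Qed.

Lemma directed_bound (L : small) (P : poset) (T : small) (F : T -> P) :
  ~ ([set: L] #<= [set: kappa R]) -> directed L P ->
  [set: T] #<= [set: kappa R] -> exists k, forall i, ple (F i) k.
Proof.
move=> Lk dP Tk; have [|k kP] := dP (F @` setT).
  apply: contra_not Lk => /card_le_trans; apply.
  exact: card_le_trans (card_image_le _ _) Tk.
by exists k => i; apply: kP; exists i.
Qed.

(** * Directed colimits of arrows and independent squares *)

Section Colimits.
Variables (L : small) (P : poset) (D : diagram Dn P).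
Hypotheses (Lk : ~ ([set: L] #<= [set: kappa R])) (dP : directed L P).

Lemma directed_ub (F : nat -> P) : exists k, forall n, ple (F n) k.
Proof. exact: directed_bound Lk dP (card_nat_kappa R). Qed.

Lemma directed_inh : exists _ : P, True.
Proof.
have [|k _] := dP (S := set0); last by exists k.
by apply: contra_not Lk => /card_le_trans; apply; apply: card_ge0.
Qed.

Let As i := dsrc (D i).
Let Bs i := dtgt (D i).
Let tA i j (p : ple i j) : {linear As i -> As j} := fsrc (dmap D p).
Let tB i j (p : ple i j) : {linear Bs i -> Bs j} := ftgt (dmap D p).

Let tAA i j k (p : ple i j) (q : ple j k) (r : ple i k) x :
  tA r x = tA q (tA p x).
Proof. by rewrite /tA (dmap_comp D p q r). Qed.

Let tBB i j k (p : ple i j) (q : ple j k) (r : ple i k) x :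
  tB r x = tB q (tB p x).
Proof. by rewrite /tB (dmap_comp D p q r). Qed.

Lemma cocone_fsrc (c : cocone D) :
  compatible tA (fun i => fsrc (leg c i)).
Proof. by move=> i j p x; rewrite -(legP c p). Qed.

Lemma cocone_ftgt (c : cocone D) :
  compatible tB (fun i => ftgt (leg c i)).
Proof. by move=> i j p x; rewrite -(legP c p). Qed.

(** As the legs are injective, compatible maps descend to the apex. Purity and independence concern
    sequences, which live at one stage. *)
Lemma jointly_surjective_colimit (c : cocone D) :
  jointly_surjective (fun i => ftgt (leg c i)) -> is_colimit c.
Proof.
move=> cs d; have [i0 _] := directed_inh.
(* The legs are pullbacks, so they also cover the source of the apex. *)
have cs' : jointly_surjective (fun i => fsrc (leg c i)).
  move=> x; have [i [y yE]] := cs (dfun (apex c) x).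
  by have [a [_ ->]] := effective_pullback (fsqP (leg c i)) yE; exists i, a.
have [v vE] := directed_descend i0 directed_ub
  (c := fun i => ftgt (leg c i)) (d := fun i => ftgt (leg d i))
  (cocone_ftgt c) cs (fun i => pm_inj (p := _)) (cocone_ftgt d).
have [u uE] := directed_descend i0 directed_ub
  (c := fun i => fsrc (leg c i)) (d := fun i => fsrc (leg d i))
  (cocone_fsrc c) cs' (fun i => pm_inj (p := _)) (cocone_fsrc d).
have pv : epure v.
  move=> n m r x vx.
  have [k [_ [y yE]]] := lift_sequence directed_ub i0 x (cocone_ftgt c) cs.
  have ry : rim n m r y.
    apply: (pure_monoP (f := ftgt (leg d k))).
    by apply: eq_rim vx => j /=; rewrite -yE vE.
  by have := rim_map (pm_fun (ftgt (leg c k))) ry; apply: eq_rim => j /=.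
have [|s sE] := @mkdown (apex c) (apex d) u v pv.
  split=> [x|n m r b a ba].
    have [i [y <-]] := cs' x.
    by rewrite uE !fsqE vE.
  have [k [_ [y yE]]] := lift_sequence directed_ub i0 b (cocone_ftgt c) cs.
  have [|x [yx ax]] := (fsqP (leg d k)).2 n m r y a.
    by apply: eq_rim ba => j; rewrite -yE vE.
  exists (fsrc (leg c k) \o x); split.
    have := rim_map (pm_fun (ftgt (leg c k))) yx; apply: eq_rim => j /=.
    by rewrite linearB yE fsqE.
  by apply: eq_rim ax => j /=; rewrite uE.
exists s; split=> [i|s' s'E].
  by apply: eq_down => x; rewrite ftgt_comp sE vE.
apply: eq_down => y; have [i [x <-]] := cs y.
by rewrite sE vE -s'E.
Qed.

(** Sources and targets have their colimits formed separately; purity and independence are again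
    tested at one stage. *)
Lemma down_colimit : exists c : cocone D,
  is_colimit c /\ jointly_surjective (fun i => ftgt (leg c i)).
Proof.
have [i0 _] := directed_inh.
have [A [al [alc als alI]]] := directed_colimit i0 directed_ub tAA
  (fun i j p => pm_inj (p := fsrc (dmap D p))).
have [B [be [bec bes beI]]] := directed_colimit i0 directed_ub tBB
  (fun i j p => pm_inj (p := ftgt (dmap D p))).
have [|a aE] := directed_descend i0 directed_ub
   (d := fun i => be i \o dfun (D i) : {linear _ -> _}) alc als alI.
  by move=> i j p x /=; rewrite fsqE; apply: bec.
have {}aE i x : a (al i x) = be i (dfun (D i) x) := aE i x.
have bep i : epure (be i).
  move=> n m r x /(rim_stage directed_ub bec bes beI)[k [p]].
  exact: (pure_monoP (f := ftgt (dmap D p))).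
have [|a' a'E] := @mkpure _ _ _ a.
  move=> n m r x ax.
  have [k [_ [y yE]]] := lift_sequence directed_ub i0 x alc als.
  have ry : rim n m r y.
    apply: (pure_monoP (f := dfun (D k))); apply: (bep k).
    by apply: eq_rim ax => j /=; rewrite -yE aE.
  by have := rim_map (al k) ry; apply: eq_rim => j /=.
pose X : arrow (RMod_pure R) := @Arrow (RMod_pure R) A B a'.
have legX i : exists s : indep_square Sq (D i) X, ftgt s =1 be i.
  apply: (@mkdown (D i) X (al i) (be i) (bep i)).
  split=> [x|n m r b c bc]; first by rewrite [RHS]a'E aE.
  (* Once [c] is lifted to a stage [k] above [i], independence of the transition square from [i] to
     [k] supplies [x]. *)
  have [k [ik [y yE]]] := lift_sequence directed_ub i c alc als.
  have [|x [bx yx]] := (fsqP (dmap D ik)).2 n m r b y.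
    apply: (bep k); apply: eq_rim bc => j /=.
    by rewrite linearB bec -aE yE -a'E.
  exists x; split=> //; have := rim_map (al k) yx; apply: eq_rim => j /=.
  by rewrite linearB yE (alc _ _ ik).
pose lg i : mor (D i) (X : Dn) := sval (cid (legX i)).
have lgE i x : ftgt (lg i) x = be i x := svalP (cid (legX i)) x.
have lgP i j (p : ple i j) : (lg j ∘ dmap D p)%cat = lg i.
  by apply: eq_down => x; rewrite ftgt_comp !lgE; apply: bec.
pose c := @Cocone _ _ D (X : Dn) lg lgP.
have cs : jointly_surjective (fun i => ftgt (leg c i)).
  by move=> y; have [i [x <-]] := bes y; exists i, x; rewrite /= lgE.
by exists c; split=> //; apply: jointly_surjective_colimit.
Qed.

(** Any colimit is compared with the concrete one; uniqueness makes the composite [v ∘ u] the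
    identity, so surjectivity carries over. *)
Lemma colimit_jointly_surjective (c : cocone D) :
  is_colimit c -> jointly_surjective (fun i => ftgt (leg c i)).
Proof.
move=> cc; have [c' [cc' cs']] := down_colimit.
have [u [uE _]] := cc c'; have [v [vE _]] := cc' c.
have [w [wE wU]] := cc c.
have vu : (v ∘ u)%cat = idm (apex c).
  rewrite -(wU (v ∘ u)%cat) => [|i]; last by rewrite -compmA uE vE.
  by apply: wU => i; rewrite comp1m.
move=> y; have [i [x xE]] := cs' (ftgt u y); exists i, x.
by rewrite -vE ftgt_comp xE -ftgt_comp vu.
Qed.

End Colimits.

(** The image of a map from [G] has at most kappa elements, so it lies in one stage and
    [down_factor] lifts the map there. Lifts agree at later stages because all maps are monic. *)
Lemma small_presentable (L : small) (G : Dn) :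
  ~ ([set: L] #<= [set: kappa R]) -> [set: dtgt G] #<= [set: kappa R] ->
  presentable L G.
Proof.
move=> Lk Gk P D c dP cc.
have cs := colimit_jointly_surjective Lk dP cc.
have lift (s : mor G (apex c)) :
    exists k (t : mor G (D k)), (leg c k ∘ t)%cat = s.
  have [F FE] := choice (fun x => cs (ftgt s x)).
  have [k kP] := directed_bound F Lk dP Gk; exists k.
  apply: down_factor => x; have [y <-] := FE x.
  by exists (ftgt (dmap D (kP x)) y); rewrite -ftgt_comp legP.
move=> d.
have wd i j (s : mor G (D i)) (t : mor G (D j)) :
    (leg c i ∘ s)%cat = (leg c j ∘ t)%cat -> leg d i s = leg d j t.
  move=> e; have [k [ik jk]] := ub2 (directed_ub Lk dP) i j.
  have e' : (dmap D ik ∘ s)%cat = (dmap D jk ∘ t)%cat.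
    by apply: (down_monic (t := leg c k)); rewrite !compmA !legP.
  transitivity (leg d k (dmap D ik ∘ s)%cat).
    exact: esym (congr1 (fun h => h s) (legP d ik)).
  rewrite e'; exact: (congr1 (fun h => h t) (legP d jk)).
have [s|u uE] := choice (P := fun s x => exists i t,
    (leg c i ∘ t)%cat = s /\ leg d i t = x).
  by have [i [t tE]] := lift s; exists (leg d i t), i, t.
exists u; split=> [i|u' u'E]; apply/funext => s /=.
  by have [j [t [/wd <- ->]]] := uE (leg c i ∘ s)%cat.
by have [j [t [<- <-]]] := uE s; rewrite -u'E.
Qed.

End Down.

(** * Small subobjects *)

Section Hull.
Variables (R : pzRingType) (B : Type).
Variables (F : kappa R -> (nat -> B) -> B) (U : kappa R -> B).

(** The flag in [kproj 0] is 0 to reuse an element of the previous stage; otherwise [F] with index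
    [kproj 1] is applied to the arguments coded by the remaining projections. *)
Fixpoint hull_stage (k : nat) (c : kappa R) : B :=
  if k is k'.+1 then
    if (kproj 0 c 0%N).1 is 0%N then hull_stage k' (kproj 1 c)
    else F (kproj 1 c) (fun i => hull_stage k' (kproj i.+2 c))
  else U c.

Lemma hull_stageS k c : exists d, hull_stage k.+1 d = hull_stage k c.
Proof.
have [d dE] := kproj_surj (fun i => if i is 0%N then fun=> (0%N, 0) else c).
by exists d; rewrite /= !dE.
Qed.

Lemma hull_stageD k l c : exists d, hull_stage (k + l) d = hull_stage k c.
Proof.
elim: l => [|l [d dE]]; first by exists c; rewrite addn0.
have [d' d'E] := hull_stageS (k + l) d.
by exists d'; rewrite addnS d'E.
Qed.

(** Although [F] takes sequences, only finitely many entries are prescribed; they meet at a finite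
    stage, so omega stages suffice. *)
Lemma skolem_hull : exists e : kappa R -> B,
  (forall c, exists d, e d = U c) /\
  forall n (x : nat -> B), (forall i, (i < n)%N -> exists d, e d = x i) ->
    exists y, (forall i, (i < n)%N -> y i = x i) /\
              forall c, exists d, e d = F c y.
Proof.
pose e (c : kappa R) := hull_stage (kproj 0 c 0%N).1 (kproj 1 c).
have eE k c : exists d, e d = hull_stage k c.
  have [d dE] := kproj_surj (fun i => if i is 0%N then fun=> (k, 0) else c).
  by exists d; rewrite /e !dE.
exists e; split=> [c|n x xe]; first exact: (eE 0%N).
have [k kE] : exists k, forall i, (i < n)%N -> exists d, hull_stage k d = x i.
  elim: n xe => [|n IH] xe; first by exists 0%N.
  have [k kE] := IH (fun i ni => xe i (ltnW ni)).
  have [d dE] := xe n (ltnSn n); set l := (kproj 0 d 0%N).1 in dE.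
  exists (k + l)%N => i; rewrite ltnS leq_eqVlt => /orP[/eqP ->|/kE[c <-]].
    by rewrite -dE addnC; apply: hull_stageD.
  exact: hull_stageD.
(* Entries from [n] on get arbitrary codes, so every argument of [F] lies at stage [k]. *)
have [i|t tE] := choice (P := fun i d => (i < n)%N -> hull_stage k d = x i).
  have [/kE[d dE]|_] := ltnP i n; first by exists d.
  by exists (fun=> (0%N, 0)).
exists (fun i => hull_stage k (t i)); split=> // c.
have [d dE] := kproj_surj (fun i => match i with
  | 0%N => fun=> (1%N, 0) | 1%N => c | i.+2 => t i end).
have [d' d'E] := eE k.+1 d; exists d'; rewrite d'E /= !dE.
by congr (F _ _); apply/funext => i; rewrite dE.
Qed.

End Hull.

(** * Hulls closed under solutions of linear systems *)

Section SmallSubobjects.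
Variable R : pzRingType.
Local Notation Dn := (down (effective_squares_weakly_stable R)).

(** An element of [kappa] codes a linear system: natural components hold the sizes, ring components
    the matrices, with [w] selecting the matrix. *)
Definition code_num (d : kappa R) (i : nat) : nat := (d i).1.
Definition code_coef (d : kappa R) (w j q : nat) : R :=
  (d (pickle (w, j, q))).2.

Lemma code_surj (num : nat -> nat) (coef : nat -> nat -> nat -> R) :
  exists d, code_num d = num /\ code_coef d = coef.
Proof.
exists (fun k => (num k,
  if unpickle k is Some (w, j, q) then coef w j q else 0)).
split; first exact/funext.
apply/funext => w; apply/funext => j; apply/funext => q.
by rewrite /code_coef pickleK.
Qed.

Lemma sum_delta (M : lmodType R) n (b : nat -> M) j : (j < n)%N ->
  \sum_(q < n) (j == q :> nat)%:R *: b q = b j.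
Proof.
move=> jn; rewrite (bigD1 (Ordinal jn))//= eqxx scale1r big1 ?addr0// => i ij.
by rewrite eq_sym (negbTE (ij : (i : nat) != j)) scale0r.
Qed.

Section System.
Variables (A B : lmodType R) (a : A -> B).

(** The parameters are [b]; the unknowns are [y] in [B] and [x] in [A]. Closure under the module
    operations, purity and independence all take this shape. *)
Definition solves (p n m l : nat) (c r s : nat -> nat -> R)
    (b y : nat -> B) (x : nat -> A) : Prop :=
  forall j, (j < n)%N -> \sum_(q < p) c j q *: b q =
    \sum_(i < m) r j i *: y i + \sum_(i < l) s j i *: a (x i).

(** One solution is fixed for each code and parameter sequence; its entries are the Skolem
    operations closing the hull. *)
Lemma system_hull (U : kappa R -> B) : exists e : kappa R -> B,
  (forall c, exists d, e d = U c) /\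
  forall p n m l c r s b y x,
    (forall q, (q < p)%N -> exists d, e d = b q) ->
    solves p n m l c r s b y x ->
    exists y' x', [/\ forall i, exists d, e d = y' i,
      forall i, exists d, e d = a (x' i) & solves p n m l c r s b y' x'].
Proof.
pose sol (d : kappa R) (b : nat -> B) (z : (nat -> B) * (nat -> A)) :=
  solves (code_num d 0) (code_num d 1) (code_num d 2) (code_num d 3)
    (code_coef d 0) (code_coef d 1) (code_coef d 2) b z.1 z.2.
have [Z ZE] : {Z : kappa R * (nat -> B) -> (nat -> B) * (nat -> A) &
    forall db, (exists z, sol db.1 db.2 z) -> sol db.1 db.2 (Z db)}.
  apply: (choice (P := fun db z => (exists z, sol db.1 db.2 z) ->
    sol db.1 db.2 z)) => -[d b].
  have [[z zE]|nz] := pselect (exists z, sol d b z); first by exists z.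
  by exists (fun=> 0, fun=> 0) => /nz.
(* [kproj 0 d] is the system; [kproj 1 d] tells whether an entry of [y] or of [x] is returned, and
   which one. *)
pose F (d : kappa R) b := let z := Z (kproj 0 d, b) in
  let i := (kproj 1 d 1%N).1 in
  if (kproj 1 d 0%N).1 is 0%N then z.1 i else a (z.2 i).
have [e [eU eF]] := skolem_hull F U; exists e; split=> //.
move=> p n m l c r s b y x be yx.
have [b' [b'b b'F]] := eF p b be.
have [d [dn dc]] := code_surj (nth 0%N [:: p; n; m; l])
  (fun w => nth c [:: c; r; s] w).
have solE z : sol d b' z = solves p n m l c r s b z.1 z.2.
  have bE j : \sum_(q < p) c j q *: b' q = \sum_(q < p) c j q *: b q.
    by apply: eq_bigr => q _; rewrite b'b.
  rewrite /sol dn dc; apply/propext.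
  by split=> sz j /sz /=; rewrite bE.
have dF k : exists d', e d' = F (sval (cid (kproj_pair d k))) b' by apply: b'F.
have FE k : F (sval (cid (kproj_pair d k))) b' =
    if (k 0%N).1 is 0%N then (Z (d, b')).1 (k 1%N).1
    else a ((Z (d, b')).2 (k 1%N).1).
  by rewrite /F; case: cid => d' /= [-> ->].
exists (Z (d, b')).1, (Z (d, b')).2; split.
- move=> i; have := dF (fun k => if k is 0%N then (0%N, 0) else (i, 0)).
  by rewrite FE.
- move=> i; have := dF (fun k => if k is 0%N then (1%N, 0) else (i, 0)).
  by rewrite FE.
- by rewrite -solE; apply: (ZE (d, b')); exists (y, x); rewrite solE.
Qed.

End System.

Definition small_arrow : small :=
  {QA : premodule R (kappa R) & {QB : premodule R (kappa R) &
    pure_mono (quot QA) (quot QB)}}.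

Definition decode (s : small_arrow) : Dn :=
  @Arrow (RMod_pure R) (quot (tag s)) (quot (tag (tagged s)))
    (tagged (tagged s)).

Lemma card_decode (s : small_arrow) : [set: dtgt (decode s)] #<= [set: kappa R].
Proof.
have qs : [set: dtgt (decode s)] `<=` qpi (tag (tagged s)) @` setT.
  by move=> q _; have [x <-] := qpi_surj q; exists x.
exact: card_le_trans (subset_card_le qs) (card_image_le _ _).
Qed.

(** The target is the hull of [U], the source its preimage under [a]. Each required property asks to
    solve in the hull a system already solvable in [X]. *)
Lemma small_subobject (X : Dn) (U : kappa R -> dtgt X) :
  exists (s : small_arrow) (u : mor (decode s) X),
    forall c, exists y, ftgt u y = U c.
Proof.
pose a := dfun X; have [e [eU eS]] := system_hull a U.
pose zA (i : nat) : dsrc X := 0; pose zB (i : nat) : dtgt X := 0.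
pose id (j q : nat) : R := (j == q)%:R.
have aI : injective a := pm_inj (p := a).
have [t0 t0E] : exists t, e t = 0.
  have [||y [x [/(_ 0%N)[t tE] _ /(_ 0%N isT)]]] :=
    eS 0%N 1%N 1%N 0%N id id id zB zB zA.
  - by [].
  - by move=> j _; rewrite !big_ord0 big_ord1 scaler0 addr0.
  rewrite !big_ord0 big_ord1 /id eqxx scale1r addr0 => y0.
  by exists t; rewrite tE.
have eD s t : exists u, e u = e s + e t.
  have [||y [x [/(_ 0%N)[u uE] _ /(_ 0%N isT)]]] :=
    eS 2%N 1%N 1%N 0%N (fun _ _ => 1) id id
     (fun q => if q is 0%N then e s else e t) (fun=> e s + e t) zA.
  - by move=> [|q] _; [exists s | exists t].
  - move=> [|//] _; rewrite big_ord0 big_ord1 big_ord_recl big_ord1 /=.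
    by rewrite /id !scale1r addr0.
  rewrite big_ord0 big_ord1 big_ord_recl big_ord1 /= /id !scale1r addr0 => y0.
  by exists u; rewrite uE y0.
have eZ h t : exists u, e u = h *: e t.
  have [||y [x [/(_ 0%N)[u uE] _ /(_ 0%N isT)]]] :=
    eS 1%N 1%N 1%N 0%N (fun _ _ => h) id id (fun=> e t) (fun=> h *: e t) zA.
  - by move=> q _; exists t.
  - by move=> [|//] _; rewrite big_ord0 !big_ord1 /id !scale1r addr0.
  rewrite big_ord0 !big_ord1 /id !scale1r addr0 => y0.
  by exists u; rewrite uE y0.
have [QB [iB [iBI iBE]]] := range_submodule t0E eD eZ.
have iBP y : (exists t, e t = y) <-> exists q, iB q = y.
  split=> [[t <-]|[q <-]]; first by exists (qpi QB t); rewrite iBE.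
  by have [t <-] := qpi_surj q; exists t; rewrite iBE.
(* [eA] enumerates the preimage of the hull, with default 0 at codes of elements outside the image
   of [a]. *)
have [eA eAE] : {eA : kappa R -> dsrc X & forall t,
    a (eA t) = e t \/ eA t = 0 /\ ~ exists x, a x = e t}.
  apply: (choice (P := fun t x' =>
    a x' = e t \/ x' = 0 /\ ~ exists x, a x = e t)) => t.
  have [[x xE]|nx] := pselect (exists x, a x = e t); first by exists x; left.
  by exists 0; right.
have eAP x : (exists t, eA t = x) <-> exists t, e t = a x.
  split=> [[t <-]|[t tE]].
    have [->|[-> _]] := eAE t; first by exists t.
    by exists t0; rewrite linear0.
  exists t; have [|[_ []]] := eAE t; last by exists x.
  by rewrite tE => /aI.
have eA' t : exists u, e u = a (eA t) by apply/eAP; exists t.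
have [tA0 tA0E] : exists t, eA t = 0.
  by apply/eAP; exists t0; rewrite linear0.
have eAD s t : exists u, eA u = eA s + eA t.
  apply/eAP; rewrite linearD; have [u <-] := eA' s; have [v <-] := eA' t.
  exact: eD.
have eAZ h t : exists u, eA u = h *: eA t.
  by apply/eAP; rewrite linearZ; have [u <-] := eA' t; apply: eZ.
have [QA [iA [iAI iAE]]] := range_submodule tA0E eAD eAZ.
have iAP x : (exists t, e t = a x) <-> exists q, iA q = x.
  rewrite -eAP; split=> [[t <-]|[q <-]].
    by exists (qpi QA t); rewrite iAE.
  by have [t <-] := qpi_surj q; exists t; rewrite iAE.
have [q|g gE] := lin_factor (f := a \o iA : {linear _ -> _}) iBI.
  by apply/iBP/iAP; exists q.
have {}gE q : iB (g q) = a (iA q) := gE q.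
have iBp : epure iB.
  move=> n m r x [y yE].
  have [||y' [x' [y'e _ y'E]]] :=
    eS n n m 0%N id r id (iB \o x) y zA.
  - by move=> q _; apply/iBP; exists (x q).
  - by move=> j jn; rewrite sum_delta// big_ord0 addr0 yE.
  have {}y'e i : exists q, iB q = y' i by apply/iBP.
  have [z zE] := choice y'e; exists z => j jn; apply: iBI.
  have := y'E j jn; rewrite sum_delta// big_ord0 addr0 /= => ->.
  by rewrite linear_sum; apply: eq_bigr => i _; rewrite linearZ zE.
have iAp : epure iA.
  move=> n m r x [y yE].
  have [||y' [x' [_ x'e x'E]]] :=
    eS n n 0%N m id id r (a \o iA \o x) zB y.
  - by move=> q _; apply/iAP; exists (x q).
  - move=> j jn; rewrite sum_delta// big_ord0 add0r.
    have /= -> := yE j jn; rewrite linear_sum.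
    by apply: eq_bigr => i _; rewrite linearZ.
  have {}x'e i : exists q, iA q = x' i by apply/iAP.
  have [z zE] := choice x'e; exists z => j jn; apply/iAI/aI.
  have := x'E j jn; rewrite sum_delta// big_ord0 add0r /= => ->.
  rewrite !linear_sum; apply: eq_bigr => i _.
  by rewrite !linearZ zE.
have gp : epure g.
  move=> n m r x gx; apply: iAp; apply: (pure_monoP (f := a)).
  by have := rim_map iB gx; apply: eq_rim => j /=.
have [g' g'E] := mkpure gp.
pose s : small_arrow := existT _ QA (existT _ QB g').
have [|u uE] := @mkdown R (decode s) X iA iB iBp; last first.
  exists s, u => c; have [d <-] := eU c.
  by exists (qpi QB d); rewrite uE iBE.
split=> [x|n m r b c [y yE]]; first by rewrite -gE -g'E.
(* The system [b = r y + a x] has solution [y], [c] in [X]; solving it in the hull replaces [c] by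
   an [x'] from the small source. *)
have [||y' [x' [y'e x'e x'E]]] := eS n n m n id r id (iB \o b) y c.
- by move=> q _; apply/iBP; exists (b q).
- move=> j jn; rewrite (sum_delta (iB \o b) jn) (sum_delta (a \o c) jn).
  by rewrite -yE//= subrK.
have {}y'e i : exists q, iB q = y' i by apply/iBP.
have {}x'e i : exists q, iA q = x' i by apply/iAP.
have [w wE] := choice y'e; have [z zE] := choice x'e.
exists z; have H : rim n m r (fun j => b j - g (z j)).
  exists w => j jn; apply: iBI.
  have := x'E j jn; rewrite (sum_delta (iB \o b) jn) (sum_delta (a \o x') jn).
  rewrite /= linearB => ->.
  rewrite gE zE addrK linear_sum; apply: eq_bigr => i _.
  by rewrite linearZ wE.
split; first by apply: eq_rim H => j; rewrite -g'E.
(* [a (c - iA z)] is the difference of the vanishing tuples [iB (b - g z)] and [iB b - a c]. *)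
apply: (pure_monoP (f := a)).
have bc : rim n m r (fun j => iB (b j) - a (c j)) by exists y.
have := rimD (rim_map iB H) (rimN bc); apply: eq_rim => j /=.
by rewrite (linearB iB) (linearB (pm_fun a)) gE opprB addrC addrA subrK.
Qed.

End SmallSubobjects.

(** * Every arrow as a directed union of small subarrows *)

Section Accessible.
Variable R : pzRingType.
Local Notation Dn := (down (effective_squares_weakly_stable R)).
Variables (L : small) (X : Dn).
Hypotheses (Lk : ~ ([set: L] #<= [set: kappa R]))
  (LA : forall (T : small) (A : set T),
    ~ ([set: L] #<= A) -> A #<= [set: kappa R]).

(** Indexing subarrows by their target image makes inclusion antisymmetric; [down_factor] turns
    inclusions into maps. *)
Definition small_image (S : set (dtgt X)) : Prop :=
  exists (s : small_arrow R) (u : mor (decode s) X), S = range (ftgt u).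

Definition small_images : poset.
Proof.
refine (@Poset {S : set (dtgt X) | small_image S}
  (fun S T => sval S `<=` sval T) _ _ _).
- by move=> S.
- by move=> S T V ST TV x /ST/TV.
- move=> [S Sp] [T Tp] /= ST TS; apply: eq_exist => /=.
  exact/seteqP.
Defined.

Lemma small_images_cover (U : kappa R -> dtgt X) :
  exists S : small_images, range U `<=` sval S.
Proof.
have [s [u uU]] := small_subobject U.
have Su : small_image (range (ftgt u)) by exists s, u.
exists (exist _ _ Su) => _ [c _ <-] /=.
by have [y yE] := uU c; exists y.
Qed.

(** A family not of size [L] has at most kappa images, each enumerated by [kappa]; pairing
    enumerates their union. *)
Lemma small_images_directed : directed L small_images.
Proof.
move=> F /LA/pfcard_geP[->|[g]].
  by have [S _] := small_images_cover (fun=> 0); exists S.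
have H (S : small_images) : exists v : kappa R -> dtgt X, range v = sval S.
  have [s [u SE]] := svalP S; rewrite SE.
  exists (ftgt u \o qpi (tag (tagged s))); apply/seteqP; split.
    by move=> _ [c _ <-]; exists (qpi (tag (tagged s)) c).
  by move=> _ [q _ <-]; have [c <-] := qpi_surj q; exists c.
have [v vE] := choice H.
have [S SE] := small_images_cover (fun c => v (g (kproj 0 c)) (kproj 1 c)).
exists S => T FT x Tx; apply: SE.
have [c _ cT] : (g @` setT) T by rewrite image_eq.
move: Tx; rewrite -vE -cT => -[d _ <-].
by have [k [<- <-]] := kproj_pair c d; exists k.
Qed.

(** An arrow is chosen for each image; as all maps are monic, functoriality is checked after
    composing with [u]. *)
Lemma small_presentation : exists (P : poset) (D : diagram Dn P) (c : cocone D),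
  [/\ directed L P, is_colimit c, apex c = X &
      forall i, exists s : small_arrow R, D i = decode s].
Proof.
have [s sE] := choice (fun S : small_images => svalP S).
pose u S := sval (cid (sE S)).
have uE S : sval S = range (ftgt (u S)) := svalP (cid (sE S)).
have le S T : ple S T -> exists d : mor (decode (s S)) (decode (s T)),
    (u T ∘ d)%cat = u S.
  move=> ST; apply: down_factor => x.
  have : sval T (ftgt (u S) x) by apply: ST; rewrite uE; exists x.
  by rewrite uE => -[y _ <-]; exists y.
pose d S T (p : ple S T) := sval (cid (le S T p)).
have dE S T (p : ple S T) : (u T ∘ d S T p)%cat = u S := svalP (cid (le S T p)).
have d1 S (p : ple S S) : d S S p = idm (decode (s S) : Dn).
  by apply: (down_monic (t := u S)); rewrite dE compm1.
have d2 S T V (p : ple S T) (q : ple T V) (r : ple S V) :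
    d S V r = (d T V q ∘ d S T p)%cat.
  by apply: (down_monic (t := u V)); rewrite compmA !dE.
pose D := @Diagram Dn small_images (fun S => decode (s S)) d d1 d2.
pose c := @Cocone Dn small_images D X u dE.
exists small_images, D, c; split=> //.
- exact: small_images_directed.
- apply: (jointly_surjective_colimit Lk small_images_directed) => y.
  have [S yS] := small_images_cover (fun=> y).
  have : sval S y by apply: yS; exists (fun=> (0%N, 0)).
  by rewrite uE => -[x _ xy]; exists S, x.
- by move=> S; exists (s S).
Qed.

End Accessible.

Theorem theorem3p6 (R : pzRingType) :
  exists I : independence (RMod_pure R), stable I.
Proof.
exists (effective_squares R), (effective_squares_weakly_stable R).
have [L [Lreg Lk LA]] := exists_kappa_successor R.
exists L; split=> //; split.
  by move=> P D dP; have [c [cc _]] := down_colimit D Lk dP; exists c.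
exists (small_arrow R), (@decode R); split.
  by move=> s; apply: small_presentable Lk (card_decode s).
by move=> X; apply: small_presentation.
Qed.
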